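(* Let $W=T^k.(\mathrm{Out}(T)\times\mathrm{Sym}(k))$ be the maximal primitive group of type SD defined in the context, with $T$ a finite nonabelian simple group and $k\ge2$. Then $W$ contains a quasi-semiregular element if and only if $k$ is prime and $|T|$ is coprime to $k$. Moreover, in that case the quasi-semiregular elements of $W$ are precisely the elements that are $W$-conjugate to elements of order $k$ of the subgroup $\mathrm{Sym}(k)$.
   Context: For $k\ge 2$ and a nonabelian finite simple group $T$, let $N=T^k$, $D=\{(t,\dots,t):t\in T\}$, $\Omega=[N:D]$ (right cosets). $N$ acts by right multiplication; $\sigma\in\mathrm{Sym}(k)$ acts by $D(t_1,\dots,t_k)\mapsto D(t_{1\sigma^{-1}},\dots,t_{k\sigma^{-1}})$ and $\alpha\in\mathrm{Aut}(T)$ by $D(t_1,\dots,t_k)\mapsto D(t_1^\alpha,\dots,t_k^\alpha)$. $W$ is the group generated by $N$ and all such $\sigma$ and $\alpha$; its point stabiliser is $\mathrm{Aut}(T)\times\mathrm{Sym}(k)$. A permutation $g$ is quasi-semiregular if $\langle g\rangle$ has a unique fixed point and acts semiregularly (only the identity fixes a point) on the remaining points. *)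

(* Defs.v *)
From mathcomp Require Import all_boot all_fingroup all_solvable.
Set Implicit Arguments. Unset Strict Implicit. Unset Printing Implicit Defensive.
Local Open Scope group_scope.

Definition SDtup (k : nat) (gT : finGroupType) := {ffun 'I_k -> gT}.

Definition SDN (k : nat) (gT : finGroupType) (T : {set gT}) : {set SDtup k gT} :=
  [set x : SDtup k gT | [forall i, x i \in T]].

(* the right coset D x, D the diagonal of T^k *)
Definition SDcoset (k : nat) (gT : finGroupType) (T : {set gT}) (x : SDtup k gT)
  : {set SDtup k gT} :=
  [set ([ffun i => t * x i] : SDtup k gT) | t in T].

Definition SDOmega (k : nat) (gT : finGroupType) (T : {set gT})
  : {set {set SDtup k gT}} :=
  [set SDcoset T x | x in SDN k T].

Definition SDpt (k : nat) (gT : finGroupType) (T : {set gT}) : finType :=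
  {S : {set SDtup k gT} | S \in SDOmega k T}.

Definition SDrmul (k : nat) (gT : finGroupType) (n : SDtup k gT) (S : {set SDtup k gT})
  : {set SDtup k gT} := [set ([ffun i => x i * n i] : SDtup k gT) | x : SDtup k gT in S].

Definition SDsym (k : nat) (gT : finGroupType) (s : 'S_k) (S : {set SDtup k gT})
  : {set SDtup k gT} := [set ([ffun i => x (s^-1 i)] : SDtup k gT) | x : SDtup k gT in S].

Definition SDaut (k : nat) (gT : finGroupType) (a : {perm gT}) (S : {set SDtup k gT})
  : {set SDtup k gT} := [set ([ffun i => a (x i)] : SDtup k gT) | x : SDtup k gT in S].

Definition SDsymgens (k : nat) (gT : finGroupType) (T : {set gT})
  : {set {perm SDpt k T}} :=
  [set g : {perm SDpt k T} | [exists s : 'S_k,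
      [forall w : SDpt k T, val (g w) == SDsym s (val w)]]].

Definition SDgens (k : nat) (gT : finGroupType) (T : {set gT})
  : {set {perm SDpt k T}} :=
  [set g : {perm SDpt k T} |
     [exists n in SDN k T, [forall w : SDpt k T, val (g w) == SDrmul n (val w)]]
  || [exists s : 'S_k, [forall w : SDpt k T, val (g w) == SDsym s (val w)]]
  || [exists a in Aut T, [forall w : SDpt k T, val (g w) == SDaut a (val w)]]].

Definition SDW (k : nat) (gT : finGroupType) (T : {set gT}) : {set {perm SDpt k T}} :=
  <<SDgens k T>>.

Definition SDSym (k : nat) (gT : finGroupType) (T : {set gT}) : {set {perm SDpt k T}} :=
  SDsymgens k T.

Definition quasi_semiregular (X : finType) (g : {perm X}) : Prop :=
  exists w : X,
    [/\ g w = w,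
        (forall x : X, g x = x -> x = w) &
        (forall (x : X) (m : nat), x != w -> (g ^+ m) x = x -> g ^+ m = 1)].

(* Main.v *)
Require Import Defs.
From mathcomp Require Import all_boot all_fingroup all_solvable ssralg.
Set Implicit Arguments. Unset Strict Implicit. Unset Printing Implicit Defensive.
Local Open Scope group_scope.

(** W is transitive, and the stabilizer of the coset D consists of the maps
    D(x_i) |-> D(a (x_(s^-1 i))) with a in Aut T and s in Sym(k).  Let such an
    element have prime order p and D as its only fixed point.  If a moves every
    nontrivial element of T, then T is nilpotent by Thompson's theorem on
    fixed-point-free automorphisms of prime order; so some t <> 1 in T is fixed
    by a, and the tuple equal to t on one s-orbit and to 1 elsewhere yields a
    second fixed point unless s is a k-cycle with k = p.  Then x_i = a^i u is
    fixed for all u, so a = 1; and x_i = d^i is fixed if d^p = 1, so p does not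
    divide #|T|.  Conversely, a fixed point of a k-cycle is given by
    x_i = d^(-i) x_0 with d^k = 1, hence d = 1.

    Thompson's theorem is deduced from his normal p-complement theorem (p odd):
    G has a normal p-complement as soon as the normalizers of J(P) and Z(P) do,
    for P a Sylow p-subgroup.  In a minimal counterexample U = O_p(G) contains
    its centralizer, G/U is the product of an abelian p'-group by P/U, and P is
    maximal.  The replacement theorem provides an abelian A of maximal order in
    P, not inside U, that is normalized by V = Z(U); so A acts quadratically on
    V, and as p is odd this forces A to centralize O_p'(G/U), a contradiction. *)

(** * Frobenius' normal p-complement theorem *)

Section PNilpotent.
Variable p : nat.
Implicit Types gT rT : finGroupType.

Definition p_nilpotent gT (A : {set gT}) := p^'.-Hall(A) 'O_p^'(A).

Lemma p_nilpotentP gT (G K : {group gT}) :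
  K <| G -> p^'.-group K -> p.-nat #|G : K| -> p_nilpotent G.
Proof.
move=> nKG p'K pGK; have hK : p^'.-Hall(G) K.
  by rewrite /pHall normal_sub // p'K pnatNK.
by rewrite /p_nilpotent (normal_Hall_pcore hK nKG).
Qed.

Lemma p_nilpotentS gT (G H : {group gT}) :
  H \subset G -> p_nilpotent G -> p_nilpotent H.
Proof.
move=> sHG nilG; have h := setI_normal_Hall (pcore_normal _ G) nilG sHG.
have nH : 'O_p^'(G) :&: H <| H by rewrite setIC (normalGI sHG) ?gFnormal.
by rewrite /p_nilpotent (normal_Hall_pcore h nH).
Qed.

Lemma morphim_p_nilpotent gT rT (G D : {group gT}) (f : {morphism D >-> rT}) :
  G \subset D -> p_nilpotent G -> p_nilpotent (f @* G).
Proof.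
move=> sGD nilG; have sOD := subset_trans (pcore_sub p^' G) sGD.
have h := morphim_pHall f sOD nilG.
have nH : f @* 'O_p^'(G) <| f @* G by rewrite morphim_normal ?gFnormal.
by rewrite /p_nilpotent (normal_Hall_pcore h nH).
Qed.

Lemma quotient_p_nilpotent gT (G H : {group gT}) :
  G \subset 'N(H) -> p_nilpotent G -> p_nilpotent (G / H).
Proof. exact: morphim_p_nilpotent. Qed.

Lemma nilpotent_p_nilpotent gT (G : {group gT}) : nilpotent G -> p_nilpotent G.
Proof. exact: nilpotent_pcore_Hall. Qed.

Lemma pgroup_p_nilpotent gT (G : {group gT}) : p.-group G -> p_nilpotent G.
Proof.
move=> pG; apply: (@p_nilpotentP _ _ 1%G); rewrite ?normal1 ?pgroup1 //.
by rewrite indexg1.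
Qed.

Lemma p_nilpotent_pgroup gT (G : {group gT}) :
  p_nilpotent G -> 'O_p^'(G) = 1 -> p.-group G.
Proof. by case/and3P=> _ _ + O1; rewrite O1 indexg1 pnatNK. Qed.

Lemma p_nilpotent_cent gT (G U : {group gT}) :
  U <| G -> p.-group U -> 'O_p^'(G) \subset 'C(U).
Proof.
move=> nUG pU; have sU : U \subset 'O_p(G) by apply: pcore_max.
rewrite centsC; apply/commG1P/trivgP; rewrite -(TI_pcoreC p G G) subsetI.
rewrite (subset_trans (commgS _ (pcore_sub _ _))) ?(subset_trans (commSg _ sU)) //=;
  last by rewrite commg_subl gFnorm.
rewrite (subset_trans (commSg _ (pcore_sub _ G)) _) //.
by rewrite commg_subr gFnorm.
Qed.

End PNilpotent.

Section FrobeniusPComplement.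
Variable p : nat.

Definition local_p_nilpotent (gT : finGroupType) (G : {group gT}) :=
  forall U : {group gT}, U \subset G -> p.-group U -> U :!=: 1 ->
    p_nilpotent p 'N_G(U).

(* Downward induction on [P :&: Q]: inside 'N_G(P :&: Q), Sylow subgroups are
   conjugate under the p-complement, which centralizes [P :&: Q]. *)
Lemma local_p_nilpotent_Sylow_conj (gT : finGroupType) (G P Q : {group gT}) :
  local_p_nilpotent G -> p.-Sylow(G) P -> p.-Sylow(G) Q ->
  exists2 c, c \in 'C_G(P :&: Q) & Q :=: P :^ c.
Proof.
move=> locG; move: {2}(_ - _) (leqnn (#|P| - #|P :&: Q|)) => n.
elim: n P Q => [|n IHn] P Q.
  rewrite leqn0 subn_eq0 => cPQ sylP sylQ; exists 1; first exact: group1.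
  have /eqP eP : P :&: Q == P by rewrite eqEcard subsetIl.
  rewrite conjsg1; apply/eqP; rewrite eq_sym eqEcard -{1}eP subsetIr /=.
  by rewrite (card_Hall sylP) (card_Hall sylQ).
move=> cPQ sylP sylQ.
have [sPG pP _] := and3P sylP; have [sQG pQ _] := and3P sylQ.
have eqc : #|P| = #|Q| by rewrite (card_Hall sylP) (card_Hall sylQ).
have [sPQ | nsPQ] := boolP (P \subset Q).
  exists 1; rewrite ?group1 // conjsg1; apply/eqP.
  by rewrite eq_sym eqEcard sPQ eqc /=.
set D := (P :&: Q)%G.
have prDP : D \proper P by rewrite properE subsetIl subsetI subxx.
have prDQ : D \proper Q.
  rewrite properEcard subsetIr -eqc /=; exact: proper_card.
have sDG : D \subset G := subset_trans (subsetIl _ _) sPG.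
have [D1 | ntD] := eqVneq (D : {set gT}) 1.
  have [c Gc eQ] := Sylow_trans sylP sylQ; exists c => //.
  by rewrite D1 cent1T inE Gc inE.
have pD : p.-group D := pgroupS (subsetIl _ _) pP.
have nilN := locG D sDG pD ntD.
have ltPN := nilpotent_proper_norm (pgroup_nil pP) prDP.
have ltQN := nilpotent_proper_norm (pgroup_nil pQ) prDQ.
have sPN : 'N_P(D) \subset 'N_G(D) by rewrite setSI.
have sQN : 'N_Q(D) \subset 'N_G(D) by rewrite setSI.
have [S sylS sPS] := Sylow_superset sPN (pgroupS (subsetIl _ _) pP).
have [S' sylS' sQS'] := Sylow_superset sQN (pgroupS (subsetIl _ _) pQ).
have nDN : D <| 'N_G(D) by rewrite normalSG.
have cKD := p_nilpotent_cent nDN pD.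
have [k Kk eS'] : exists2 k, k \in 'O_p^'('N_G(D)) & S' :=: S :^ k.
  have [x Nx ->] := Sylow_trans sylS sylS'.
  have /sdprodP[_ defN _ _] : 'O_p^'('N_G(D)) ><| S = 'N_G(D).
    by apply/sdprod_Hall_p'coreP.
  have := groupVr Nx; rewrite -defN => /mulsgP[k s Kk Ss ex].
  exists k^-1; rewrite ?groupV // -[x]invgK ex invMg conjsgM.
  by rewrite (conjGid (groupVr Ss)).
have [sSN pS _] := and3P sylS.
have sSG : S \subset G := subset_trans sSN (subsetIl _ _).
have [R sylR sSR] := Sylow_superset sSG pS.
have NGk : k \in 'N_G(D) by apply: (subsetP (pcore_sub _ _)) Kk.
have Gk : k \in G by case/setIP: NGk.
have Ck : k \in 'C(D) by apply: (subsetP cKD).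
have ltD1 : #|D| < #|P :&: R|.
  apply: leq_trans (proper_card ltPN) (subset_leq_card _).
  by rewrite subsetI subsetIl (subset_trans sPS).
have ltD2 : #|D| < #|(R :^ k)%G :&: Q|.
  apply: leq_trans (proper_card ltQN) (subset_leq_card _).
  by rewrite subsetI subsetIl andbT (subset_trans sQS') // eS' conjSg.
have sylRk : p.-Sylow(G) (R :^ k)%G by rewrite pHallJ.
have shrink (m1 m2 : nat) : #|D| < m1 -> #|P| - #|D| <= n.+1 -> #|P| - m1 <= n.
  by move=> lt le; rewrite leq_subLR -ltnS; rewrite leq_subLR in le;
     apply: leq_ltn_trans le _; rewrite addnS ltnS ltn_add2r.
have [|c1 /setIP[Gc1 Cc1] eR] := IHn P R _ sylP sylR; first exact: shrink cPQ.
have [|c2 /setIP[Gc2 Cc2] eQ] := IHn (R :^ k)%G Q _ sylRk sylQ.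
  by rewrite cardJg (card_Hall sylR) -(card_Hall sylP); apply: shrink cPQ.
have C1 : c1 \in 'C(D).
  apply: (subsetP (centS _)) Cc1.
  rewrite subsetI subsetIl (subset_trans _ sSR) // (subset_trans _ sPS) //.
  by rewrite subsetI subsetIl normG.
have C2 : c2 \in 'C(D).
  apply: (subsetP (centS _)) Cc2.
  rewrite subsetI subsetIr andbT /= (subset_trans _ (_ : (S :^ k) \subset _)) ?conjSg //.
  by rewrite -eS' (subset_trans _ sQS') // subsetI subsetIr normG.
exists (c1 * k * c2); first by rewrite inE !groupM.
by rewrite !conjsgM -eR eQ.
Qed.

Lemma local_p_nilpotent_fusion (gT : finGroupType) (G P : {group gT}) x g :
    local_p_nilpotent G -> p.-Sylow(G) P -> x \in P -> g \in G -> x ^ g \in P ->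
  exists2 y, y \in P & x ^ g = x ^ y.
Proof.
move=> locG sylP Px Gg Pxg; have [sPG pP _] := and3P sylP.
have [P1 | ntP] := eqVneq (P : {set gT}) 1.
  exists 1; rewrite ?group1 //; move: Px; rewrite P1 => /set1P->.
  by rewrite !conj1g.
have sylPg : p.-Sylow(G) (P :^ g)%G by rewrite pHallJ.
have [c /setIP[Gc Cc] eP] := local_p_nilpotent_Sylow_conj locG sylPg sylP.
have nilN := locG P sPG pP ntP.
have nPN : P <| 'N_G(P) by rewrite normalSG.
have sylPN : p.-Sylow('N_G(P)) P.
  by apply: pHall_subl sylP; rewrite ?subsetIl ?normal_sub.
have cKP := p_nilpotent_cent nPN pP.
have : g * c \in 'N_G(P).
  by rewrite inE groupM //=; apply/normP; rewrite conjsgM.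
have /sdprodP[_ <- _ _] : 'O_p^'('N_G(P)) ><| P = 'N_G(P).
  by apply/sdprod_Hall_p'coreP.
case/mulsgP=> k y Kk Py egc; exists y => //.
have /(centP (subsetP cKP k Kk)) cxk := Px.
have : x ^ g * c = c * x ^ g.
  by rewrite (centP Cc) // inE Pxg memJ_conjg Px.
move=> cxg; transitivity (x ^ (g * c)).
  by rewrite conjgM [RHS]conjgE cxg mulKg.
by rewrite egc conjgM [x ^ k]conjgE -cxk mulKg.
Qed.

(* As [P] controls the fusion of its elements, the transfer from [G] to
   [P / P^`(1)] restricts to [x |-> x ^+ #|G : P|] on [P]; its kernel is a
   smaller group of [p]-power index. *)
Lemma Frobenius_p_nilpotent (gT : finGroupType) (G : {group gT}) :
  local_p_nilpotent G -> p_nilpotent p G.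
Proof.
move: {2}#|G| (leqnn #|G|) => n; elim: n G => [|n IHn] G.
  by rewrite leqNgt cardG_gt0.
move=> leGn locG; have [P sylP] := Sylow_exists p G.
have [sPG pP p'GP] := and3P sylP.
have [P1 | ntP] := eqVneq (P : {set gT}) 1.
  apply: (@p_nilpotentP _ _ _ G); rewrite ?normal_refl ?indexgg //.
  by rewrite /pgroup -(Lagrange sPG) {1}P1 cards1 mul1n.
pose al := restrm_morphism (der_norm 1 P) (coset_morphism P^`(1)).
have ab : abelian (al @* P).
  rewrite morphim_restrm setIid. exact: (der_abelian 0 P).
have alE x : al x = coset P^`(1) x by [].
pose tr := transfer_morphism G ab.
have trP x : x \in P -> tr x = (FiniteModule.fmod ab (al x) *+ #|G : P|)%R.
  move=> Px; have Gx := subsetP sPG x Px.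
  have parX := rcosets_cycle_partition sPG Gx.
  have trX := transversalP parX.
  rewrite /= (transfer_cycle_expansion sPG ab Gx trX).
  rewrite -(sum_index_rcosets_cycle sPG Gx trX) -GRing.sumrMnr.
  apply: eq_bigr => y Xy.
  have Gy : y \in G by apply: (subsetP (transversal_sub trX)).
  set m := #|_ : _|.
  have [|||z Pz ->] := @local_p_nilpotent_fusion _ G P (x ^+ m) y^-1 locG sylP.
  - by rewrite groupX.
  - by rewrite groupV.
  - have := mulg_exp_card_rcosets P x y.
    by rewrite mem_rcoset conjgE invgK mulgA.
  have Axm : al x ^+ m \in al @* P by rewrite groupX ?mem_morphim.
  have eal : al (x ^+ m ^ z) = al x ^+ m.
    rewrite morphJ ?groupX // morphX // conjgE (centsP ab _ Axm (al z)) ?mem_morphim //.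
    by rewrite mulKg.
  rewrite -FiniteModule.fmodX ?mem_morphim // -eal.
  by [].
have [sKG nKG] := andP (ker_normal tr).
have sKP : 'ker tr :&: P \subset P^`(1).
  apply/subsetP=> x /setIP[Kx Px].
  have Ax : al x \in al @* P by rewrite mem_morphim.
  apply: coset_idr; first exact: subsetP (der_norm 1 P) x Px.
  rewrite -alE; have /eqP := mker Kx; rewrite trP // -FiniteModule.fmodX //.
  rewrite -(morph1 (FiniteModule.fmod_morphism ab)) => /eqP.
  move/(injmP (FiniteModule.injm_fmod ab)) => /(_ (groupX _ Ax) (group1 _)) xm1.
  have p_al : p.-elt (al x) by apply: mem_p_elt (morphim_pgroup _ pP) Ax.
  apply/eqP; rewrite -order_eq1 -dvdn1 -(@Gauss_dvdl _ 1 #|G : P|) ?mul1n.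
    by rewrite order_dvdn xm1.
  exact: pnat_coprime p_al p'GP.
have ltKG : 'ker tr \proper G.
  rewrite properE sKG; apply: contraL (sol_der1_proper (pgroup_sol pP) (subxx P) ntP).
  move=> sGK; rewrite properE negb_and der_sub negbK.
  by rewrite (subset_trans _ sKP) // subsetI subxx (subset_trans sPG).
have nilK : p_nilpotent p ('ker tr).
  apply: IHn => [|U sUK pU ntU]; first by rewrite -ltnS (leq_trans (proper_card ltKG)).
  by apply: p_nilpotentS (locG U (subset_trans sUK sKG) pU ntU); rewrite setSI.
have pGK : p.-nat #|G : 'ker tr|.
  rewrite -{1}(setIid G) -card_morphim.
  have sA : tr @* G \subset FiniteModule.fmod_morphism ab @* (al @* P).
    apply/subsetP=> u _; apply/morphimP.
    have uA := FiniteModule.fmodP u; exists (FiniteModule.fmval u) => //.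
    exact/esym/FiniteModule.fmvalK.
  exact: pgroupS sA (morphim_pgroup _ (morphim_pgroup _ pP)).
apply: (@p_nilpotentP _ _ _ 'O_p^'('ker tr)).
- by rewrite gFnormal_trans ?ker_normal.
- exact: pcore_pgroup.
rewrite -(Lagrange_index sKG (pcore_sub _ _)) pnatM pGK /=.
by case/and3P: nilK => _ _; rewrite pnatNK.
Qed.
End FrobeniusPComplement.

(** * Quadratic action and Thompson's replacement theorem *)

Section QuadraticZmod.
Import GRing.Theory.
Local Open Scope ring_scope.
Variables (M : zmodType) (L n : M -> M) (j : nat).
Hypotheses (LD : {morph L : x y / x + y}) (LN : {morph L : x / - x}).
Hypotheses (nD : {morph n : x y / x + y}) (nN : {morph n : x / - x}).
Hypothesis tor2 : forall v : M, v *+ 2 = 0 -> v = 0.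
Hypothesis torj : forall v : M, v *+ j = 0 -> v = 0.
Hypothesis Lj : forall v, iter j L v = v.
Let A v := v + n v.
Let B v := v - n v.
Hypothesis comA : forall v, A (L (B (L v))) = L (A (L (B v))).
Hypothesis comB : forall v, B (L (A (L v))) = L (B (L (A v))).

(* The sum and the difference of [comA] and [comB] say that [L] commutes with
   the commutator of [L] and [n]; the powers of [L] then move [n] along an
   arithmetic progression, which is constant because [L] has finite order. *)
Lemma quadratic_comm v : L (n v) = n (L v).
Proof.
have eq2 u : L (L (n u)) - L (n (L u)) = L (n (L u)) - n (L (L u)).
  have:= comB u; have:= comA u; rewrite /A /B !(LD, nD, LN, nN).
  move: (L (L u)) (L (n (L u))) (n (L (L u))) (n (L (n (L u)))) (L (L (n u)))
        (L (n (L (n u)))) => U X Y S Z T.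
  rewrite -!addrA => /addrI H1 /addrI H2.
  have dbl (b c d : M) : - b + (c - d) - (b - (c + d)) = (c - b) *+ 2.
    by rewrite [- (b - _)]opprB [- b + _]addrC [c - d - b]addrAC [c + d - b]addrAC
               addrACA addNr addr0 mulr2n.
  apply/eqP; rewrite -subr_eq0; apply/eqP/tor2.
  have := dbl X Y S; rewrite H1 H2 dbl => e.
  by rewrite -[Z - X]opprB -opprD mulNrn mulrnDl e -mulrnDl addrA subrK subrr mul0rn oppr0.
pose c u := L (n u) - n (L u).
have cL u : c (L u) = L (c u) by rewrite /c LD LN eq2.
have L0 : L 0 = 0 by rewrite -(subrr 0) LD LN !subrr.
have LMn w m : L (w *+ m) = L w *+ m.
  by elim: m => [|m IHm]; rewrite ?mulr0n // !mulrS LD IHm.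
have step i u : iter i.+1 L (n u) = n (iter i.+1 L u) + c (iter i L u) *+ i.+1.
  elim: i u => [|i IHi] u; first by rewrite /= mulr1n /c addrC subrK.
  rewrite iterS IHi LD [in RHS]mulrS.
  rewrite LMn -cL -[L (iter _ _ _)]/(iter i.+1 L u).
  by rewrite addrA; congr (_ + _); rewrite /c addrC subrK.
have c0 u : c u = 0.
  case: j Lj torj => [_ t0|i Li ti]; first exact: t0.
  have := step i (L u); rewrite !Li -[LHS]addr0 => /addrI/esym/ti.
  by rewrite -iterSr Li.
by apply/eqP; rewrite -subr_eq0; apply/eqP/c0.
Qed.
End QuadraticZmod.

Lemma quadratic_cent (gT : finGroupType) (V : {group gT}) (x a : gT) (j : nat) :
    abelian V -> odd #|V| -> coprime #|V| j -> x \in 'N(V) -> a \in 'N(V) ->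
    {in V, forall v, [~ v, a, a] = 1} -> x ^+ j \in 'C(V) ->
    [~ x, x ^ a] \in 'C(V) -> [~ x, x ^ a^-1] \in 'C(V) ->
  [~ x, a] \in 'C(V).
Proof.
move=> abV oddV coVj Nx Na quad cxj cxa cxa'.
pose M := FiniteModule.fmod_of abV.
have valJ := @FiniteModule.fmvalJ _ _ abV.
have actE (y z : gT) : y \in 'N(V) -> z \in 'N(V) -> [~ y, z] \in 'C(V) ->
    forall u : M, FiniteModule.actr (FiniteModule.actr u y) z =
                  FiniteModule.actr (FiniteModule.actr u z) y.
  move=> Ny Nz cyz u; apply: FiniteModule.fmod_inj; rewrite !valJ //.
  set v := FiniteModule.fmval u; have Vv : v \in V := FiniteModule.fmodP u.
  rewrite -!conjgM [y * z]commgC conjgM [RHS]conjgE [LHS]conjgE.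
  have Vv' : v ^ (z * y) \in V by rewrite memJ_norm ?groupM.
  by rewrite -(centP cyz _ Vv') mulKg.
have torM m (v : M) : coprime #|V| m -> (v *+ m = 0 -> v = 0)%R.
  move=> co vm; apply: FiniteModule.fmod_inj.
  have Vv : FiniteModule.fmval v \in V := FiniteModule.fmodP v.
  by rewrite -(expgK co Vv) -FiniteModule.fmvalZ vm FiniteModule.fmval0 expg1n.
pose act y (u : M) : M := FiniteModule.actr u y.
have actD y := @FiniteModule.actAr _ _ abV y; have actN y := @FiniteModule.actNr _ _ abV y.
have actM y z u : y \in 'N(V) -> z \in 'N(V) -> act (y * z) u = act z (act y u).
  by move=> Ny Nz; exact: FiniteModule.actrM.
pose n (u : M) : M := (act a u - u)%R.
have nD : {morph n : u v / (u + v)%R} by move=> u v; rewrite /n /act actD GRing.opprD GRing.addrACA.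
have nN : {morph n : u / (- u)%R} by move=> u; rewrite /n /act actN GRing.opprD.
have nn u : n (n u) = 0%R.
  apply: FiniteModule.fmod_inj; rewrite FiniteModule.fmval0.
  rewrite -(quad (FiniteModule.fmval u) (FiniteModule.fmodP u)) /n /act.
  rewrite GRing.addrC [(_ - u)%R]GRing.addrC.
  by rewrite !(FiniteModule.fmvalA, FiniteModule.fmvalN, valJ).
have AE u : (u + n u)%R = act a u by rewrite /n GRing.addrC GRing.subrK.
have BE u : (u - n u)%R = act a^-1 u.
  rewrite -[LHS](@FiniteModule.actrK _ _ abV a) -[FiniteModule.actr _ a]/(act a _).
  by rewrite -AE nD nN nn GRing.subr0 GRing.subrK.
have Nx' : x ^ a \in 'N(V) by rewrite groupJ.
have Nx'' : x ^ a^-1 \in 'N(V) by rewrite groupJ ?groupV.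
have actJ u b : b \in 'N(V) -> act (x ^ b) u = act b (act x (act b^-1 u)).
  by move=> Nb; rewrite conjgE !actM ?groupM ?groupV.
have comA u : act a (act x (act a^-1 (act x u))) = act x (act a (act x (act a^-1 u))).
  by rewrite -!actJ //; apply: actE.
have comB u : act a^-1 (act x (act a (act x u))) = act x (act a^-1 (act x (act a u))).
  have := actE _ _ Nx Nx'' cxa' u.
  by rewrite -![FiniteModule.actr _ _]/(act _ _) !actJ ?groupV // invgK.
have Lj u : iter j (act x) u = u.
  have -> : iter j (act x) u = act (x ^+ j) u.
    elim: (j) => [|i IHi]; first by rewrite /act FiniteModule.actr1.
    by rewrite iterS IHi expgSr actM ?groupX.
  apply: FiniteModule.fmod_inj; rewrite /act valJ ?groupX // conjgE.
  by rewrite -(centP cxj _ (FiniteModule.fmodP u)) mulKg.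
have key u : act x (n u) = n (act x u).
  apply: (@quadratic_comm M (act x) n j) => //; first exact: actD; first exact: actN.
  - by move=> v; apply: torM; rewrite coprimen2.
  - by move=> v; apply: torM.
  - by move=> v; rewrite !AE !BE comA.
  - by move=> v; rewrite !AE !BE comB.
apply/centP=> v Vv; apply/commute_sym/commgP; rewrite -conjg_fix.
have Vw : v ^ (a * x)^-1 \in V by rewrite memJ_norm ?groupV ?groupM.
have e w : w \in V -> w ^ (x * a) = w ^ (a * x).
  move=> Ww; have := key (FiniteModule.fmod abV w).
  rewrite /n /act actD actN => /GRing.addIr/(congr1 val).
  rewrite !valJ // FiniteModule.fmodK // !conjgM => -> //.
have -> : [~ x, a] = (a * x)^-1 * (x * a) by rewrite invMg commgEl conjgE !mulgA.
by rewrite conjgM e // -conjgM mulVg conjg1.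
Qed.

Section ThompsonSubgroup.
Implicit Types gT rT : finGroupType.

(* Maximal order, not maximal for inclusion. *)
Definition max_abelian gT (A : {set gT}) : {set {group gT}} :=
  [set B : {group gT} | [&& B \subset A, abelian B &
    [forall C : {group gT}, (C \subset A) && abelian C ==> (#|C| <= #|B|)]]].

Definition Thompson_sub gT (A : {set gT}) := <<\bigcup_(B in max_abelian A) B>>.

Lemma max_abelianP gT (A : {set gT}) (B : {group gT}) :
  reflect [/\ B \subset A, abelian B &
             forall C : {group gT}, C \subset A -> abelian C -> #|C| <= #|B|]
          (B \in max_abelian A).
Proof.
rewrite inE; apply: (iffP and3P) => [[sBA cBB /forallP maxB] | [sBA cBB maxB]]; split=> //.
  by move=> C sCA cCC; apply: (implyP (maxB C)); rewrite sCA.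
by apply/forallP=> C; apply/implyP=> /andP[]; apply: maxB.
Qed.

Lemma max_abelian_exists gT (G B : {group gT}) :
    B \subset G -> abelian B -> exists2 A : {group gT}, A \in max_abelian G & #|B| <= #|A|.
Proof.
move=> sBG cBB.
have PB : (B \subset G) && abelian B by rewrite sBG.
case: (@arg_maxnP _ B (fun B : {group gT} => (B \subset G) && abelian B) (fun C => #|C|) PB).
move=> A /andP[sAG cAA] maxA; exists A; last exact: maxA.
by apply/max_abelianP; split=> // C sCG cCC; apply: maxA; rewrite sCG.
Qed.

Lemma max_abelian_Thompson_sub gT (A : {set gT}) (B : {group gT}) :
  B \in max_abelian A -> B \subset Thompson_sub A.
Proof. by move=> maxB; rewrite sub_gen // (bigcup_max B). Qed.

Lemma Thompson_sub_subset gT (A : {set gT}) (G : {group gT}) :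
  reflect (forall B : {group gT}, B \in max_abelian A -> B \subset G)
          (Thompson_sub A \subset G).
Proof. by rewrite gen_subG; apply: bigcupsP. Qed.

Lemma Thompson_sub_sub gT (G : {group gT}) : Thompson_sub G \subset G.
Proof. by apply/Thompson_sub_subset=> B /max_abelianP[]. Qed.

Lemma Thompson_sub_cont : GFunctor.iso_continuous (@Thompson_sub).
Proof.
move=> gT rT G f injf; rewrite sub_morphim_pre ?Thompson_sub_sub //.
apply/Thompson_sub_subset=> B /max_abelianP[sBG cBB maxB] /=.
rewrite -sub_morphim_pre //; apply: (@max_abelian_Thompson_sub _ _ (f @* B)).
apply/max_abelianP; split; rewrite ?morphimS ?morphim_abelian // => C sCfG cCC.
have sC : f @*^-1 C \subset G by apply: subsetIl.
rewrite -(morphpreK sCfG) !card_injm //; apply: maxB => //.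
by rewrite -(injm_abelian injf) // morphpreK.
Qed.

Canonical Thompson_sub_igFun := [igFun by Thompson_sub_sub & !Thompson_sub_cont].

Lemma Thompson_sub_neq1 gT (P : {group gT}) (p : nat) :
  p.-group P -> P :!=: 1 -> Thompson_sub P != 1.
Proof.
move=> pP ntP; apply: contraNneq ntP => J1; rewrite -(trivg_center_pgroup pP) //.
have [A maxA le] := max_abelian_exists (center_sub P) (center_abelian P).
have := max_abelian_Thompson_sub maxA; rewrite J1 => /trivgP A1.
by apply/trivgP; rewrite subG1 trivg_card_le1 (leq_trans le) // A1 cards1.
Qed.

(* With [x] in [V] but not in 'N(A) such that [A :^ x] normalizes [A], and
   [H := A * A :^ x], take [B := (A :&: A :^ x) * (H :&: V)]: its first factor is
   central in [H], and comparing orders gives [#|A| <= #|B|]. *)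
Lemma Thompson_replacement gT (P V A : {group gT}) (p : nat) :
    p.-group P -> A \in max_abelian P -> abelian V -> V <| P ->
    ~~ (V \subset 'N(A)) ->
  exists2 B : {group gT}, B \in max_abelian P &
    A :&: V \proper B :&: V /\ B \subset 'N(A).
Proof.
move=> pP /max_abelianP[sAP cAA maxA] cVV /andP[sVP nVP] nAV.
have nVA : A \subset 'N(V) := subset_trans sAP nVP.
set N := 'N_V(A)%G.
have nNA : A \subset 'N(N).
  by rewrite normsI ?norms_norm // (subset_trans (normG A)) ?normG.
have defM : N <*> A = N * A by rewrite norm_joinEr.
have defL : V <*> A = V * A by rewrite norm_joinEr.
have sML : N <*> A \subset V <*> A by rewrite genS // setSU // subsetIl.
have pL : p.-group (V <*> A) by apply: pgroupS pP; rewrite join_subG sVP.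
have prML : N <*> A \proper V <*> A.
  rewrite properE sML; apply: contra nAV => sLM.
  have sVM : V \subset N * A by rewrite -defM (subset_trans (joing_subl _ _) sLM).
  apply/subsetP=> v Vv; have /mulsgP[n b /setIP[Vn Nn] Ab e] := subsetP sVM v Vv.
  by rewrite e groupM // (subsetP (normG A)).
have sMN : N <*> A \subset 'N(A) by rewrite join_subG subsetIr normG.
have /properP[_ [y NLy My]] := nilpotent_proper_norm (pgroup_nil pL) prML.
have [x Vx [Nx nxA]] : exists2 x, x \in V & A :^ x \subset 'N(A) /\ x \notin 'N(A).
  case/setIP: NLy; rewrite /= defL => /mulsgP[x b Vx Ab ey] Ny.
  exists x => //; have -> : x = y * b^-1 by rewrite ey mulgK.
  have Mb : b \in N <*> A by rewrite (subsetP (joing_subr _ _)).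
  split; first (apply: subset_trans sMN; rewrite -(normP (_ : y * b^-1 \in 'N(N <*> A)))).
    by rewrite conjSg joing_subr.
  by rewrite groupM // groupV (subsetP (normG _)).
  apply: contra My => Nyb; rewrite -(mulgKV b y) groupM //.
  apply: (subsetP (joing_subl _ _)).
  by rewrite inE Nyb {1}ey mulgK Vx.

have sAxN : A :^ x \subset 'N(A) := Nx.
set H := (A <*> A :^ x)%G.
have defH : H = A * A :^ x :> {set gT} by rewrite /H /= norm_joinEr.
have sHP : H \subset P.
  by rewrite join_subG sAP /= -(conjGid (subsetP sVP x Vx)) conjSg.
have nAH : H \subset 'N(A) by rewrite join_subG normG.
set Z := (A :&: A :^ x)%G; set W := (H :&: V)%G.
have cHZ : H \subset 'C(Z).
  have cAx : abelian (A :^ x) by rewrite abelianJ.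
  rewrite join_subG (subset_trans cAA) ?centS ?subsetIl //=.
  by rewrite (subset_trans cAx) ?centS ?subsetIr.
have sAW : A :&: V \subset W by rewrite setSI ?joing_subl.
have defHW : H = A * W :> {set gT}.
  apply/eqP; rewrite eqEsubset mul_subG ?joing_subl ?subsetIl // andbT defH.
  apply/subsetP=> _ /mulsgP[a _ Aa /imsetP[b Ab ->] ->].
  have -> : a * b ^ x = (a * b) * [~ b, x] by rewrite commgEl -mulgA mulKVg.
  apply: mem_mulg; first exact: groupM.
  rewrite inE; apply/andP; split.
    rewrite commgEl groupM ?groupV //; first by rewrite (subsetP (joing_subl _ _)).
    by rewrite (subsetP (joing_subr _ _)) // memJ_conjg.
  by rewrite commgEr groupM // memJ_norm ?groupV // (subsetP nVA).
have cardH : (#|A| * #|A| = #|H| * #|Z|)%N.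
  by rewrite defH -mul_cardG cardJg.
have cardW : (#|A| * #|W| = #|H| * #|A :&: V|)%N.
  have -> : A :&: V = A :&: W.
    by rewrite setIA; congr (_ :&: V); apply/esym/setIidPl; exact: joing_subl.
  by rewrite defHW mul_cardG.
set B := (Z <*> W)%G.
have cWZ : W \subset 'C(Z) := subset_trans (subsetIl _ _) cHZ.
have defB : B = Z * W :> {set gT}.
  exact: cent_joinEr.
have cBB : abelian B.
  rewrite defB abelianM (abelianS (subsetIl _ _) cAA) (abelianS (subsetIr _ _) cVV).
  exact: cWZ.
have sBH : B \subset H.
  by rewrite join_subG subsetIl andbT (subset_trans (subsetIl _ _)) ?joing_subl.
have leAB : #|A| <= #|B|.
  have cardB : (#|Z| * #|W| = #|B| * #|Z :&: W|)%N by rewrite defB mul_cardG.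
  have leZW : #|Z :&: W| <= #|A :&: V|.
    by apply/subset_leq_card/setISS; rewrite ?subsetIl ?subsetIr.
  rewrite -(leq_pmul2r (cardG_gt0 (A :&: V)%G)) /=.
  apply: leq_trans (leq_mul (leqnn #|B|) leZW); rewrite -cardB.
  rewrite -(leq_pmul2l (cardG_gt0 A)) [X in _ <= X]mulnCA cardW [X in X <= _]mulnA cardH.
  by rewrite -mulnA mulnCA.
exists B; last split; last exact: subset_trans sBH nAH.
  apply/max_abelianP; split=> //; first exact: subset_trans sHP.
  by move=> C sCP cCC; apply: leq_trans leAB; apply: maxA.
have sWB : W \subset B :&: V by rewrite subsetI joing_subr subsetIr.
rewrite properE (subset_trans sAW sWB) /=; apply: contra nxA => sBA.
apply/normP/eqP; rewrite eqEcard cardJg leqnn andbT.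
apply: subset_trans (joing_subr A _) _; rewrite -[_ <*> _]/(gval H) defHW mul_subG //.
by apply: subset_trans (subset_trans sWB sBA) (subsetIl _ _).
Qed.

End ThompsonSubgroup.

(** * Thompson's normal p-complement theorem *)

Section ThompsonPComplement.
Variable p : nat.
Implicit Types gT rT : finGroupType.

Lemma p_nilpotent_central gT (G Z : {group gT}) :
  Z \subset 'Z(G) -> p.-group Z -> p_nilpotent p (G / Z) -> p_nilpotent p G.
Proof.
move=> sZ pZ nilGZ; have nZG : Z <| G by apply: sub_center_normal.
have [L defL sZL nLG] := inv_quotientN nZG (pcore_normal p^' (G / Z)).
have nZL : Z <| L := normalS sZL (normal_sub nLG) nZG.
have hZL : p.-Hall(L) Z.
  rewrite /pHall sZL pZ -card_quotient ?normal_norm // -defL.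
  exact: pcore_pgroup.
have /splitsP[K /complP[tiZK defZK]] := SchurZassenhaus_split (pHall_Hall hZL) nZL.
have cZK : K \subset 'C(Z).
  have sKL : K \subset L by rewrite -defZK mulG_subr.
  rewrite (subset_trans sKL) // (subset_trans (normal_sub nLG)) // centsC.
  by rewrite (subset_trans sZ) // subsetIr.
have nKL : K <| L.
  rewrite -defZK /normal mulG_subr mul_subG ?normG //.
  by rewrite cents_norm // centsC.
have p'K : p^'.-group K.
  case/and3P: hZL => _ _; rewrite -divgS // -defZK.
  by rewrite TI_cardMg // mulKn.
have pLK : p.-nat #|L : K|.
  by rewrite -divgS ?normal_sub // -defZK TI_cardMg // mulnK.
have hK : p^'.-Hall(L) K by rewrite /pHall normal_sub // p'K pnatNK.
have defK := normal_Hall_pcore hK nKL.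
apply: (@p_nilpotentP _ _ _ K) => //; first by rewrite -defK gFnormal_trans.
rewrite -(Lagrange_index (normal_sub nLG) (normal_sub nKL)) pnatM pLK andbT.
case/and3P: nilGZ => _ _; rewrite defL pnatNK.
by rewrite index_quotient_eq ?(normal_sub nLG) ?(normal_norm nZG) ?subIset ?sZL ?orbT.
Qed.

Lemma p_nilpotent_quotient_p' gT (G M : {group gT}) :
  M <| G -> p^'.-group M -> p_nilpotent p (G / M) -> p_nilpotent p G.
Proof.
move=> nMG p'M nilGM.
have [L defL sML nLG] := inv_quotientN nMG (pcore_normal p^' (G / M)).
have nML : L \subset 'N(M) := subset_trans (normal_sub nLG) (normal_norm nMG).
apply: (@p_nilpotentP _ _ _ L) => //.
  by rewrite -(pquotient_pgroup p'M nML) -defL pcore_pgroup.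
case/and3P: nilGM => _ _; rewrite defL pnatNK.
by rewrite index_quotient_eq ?(normal_sub nLG) ?(normal_norm nMG) ?subIset ?sML ?orbT.
Qed.

Lemma isog_p_nilpotent gT rT (G : {group gT}) (H : {group rT}) :
  G \isog H -> p_nilpotent p H -> p_nilpotent p G.
Proof.
rewrite isog_sym => /isogP[f injf <-] nilH; exact: morphim_p_nilpotent.
Qed.

Definition center_or_Thompson (b : bool) : GFunctor.iso_map :=
  if b then [igFun of @Thompson_sub] else [igFun of @center].

Lemma center_or_Thompson_neq1 b gT (P : {group gT}) :
  p.-group P -> P :!=: 1 -> center_or_Thompson b gT P != 1.
Proof.
move=> pP ntP; case: b; first exact: Thompson_sub_neq1 pP ntP.
by apply: contra_neq ntP => Z1; apply: trivg_center_pgroup pP Z1.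
Qed.

Definition Thompson_local gT (G : {group gT}) :=
  forall b (P : {group gT}), p.-Sylow(G) P ->
    p_nilpotent p 'N_G(center_or_Thompson b gT P).

Lemma Thompson_local_quotient_p' gT (G M : {group gT}) :
  M <| G -> p^'.-group M -> Thompson_local G -> Thompson_local (G / M).
Proof.
move=> nMG p'M locG b P1 sylP1; have nMG' := normal_norm nMG.
have [P sylP defP1] : exists2 P : {group gT}, p.-Sylow(G) P & P1 :=: P / M.
  have [Q sylQ] := Sylow_exists p G.
  have nMQ := subset_trans (pHall_sub sylQ) nMG'.
  have [y Gy eP1] := Sylow_trans (quotient_pHall nMQ sylQ) sylP1.
  have /morphimP[x Nx Gx defy] := Gy.
  exists (Q :^ x)%G; first by rewrite pHallJ.
  by rewrite eP1 defy /= quotientJ.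
have [sPG pP _] := and3P sylP; have nMP := subset_trans sPG nMG'.
set X := center_or_Thompson b gT P; have sXP : X \subset P by apply: gFsub.
have pX : p.-group X := pgroupS sXP pP.
have defX : center_or_Thompson b _ P1 = X / M.
  have injf : 'injm (restrm nMP (coset M)).
    rewrite ker_restrm ker_coset; apply/trivgP/coprime_TIg.
    by rewrite (pnat_coprime pP).
  have -> : P1 = (restrm nMP (coset M) @* P)%G.
    by apply/val_inj; rewrite /= defP1 morphim_restrm setIid.
  by rewrite -injmF // morphim_restrm (setIidPr sXP).
rewrite defX; apply: (p_nilpotentS _ (quotient_p_nilpotent _ (locG b P sylP))); last first.
  by rewrite (subset_trans (subsetIl _ _)).
apply/subsetP=> y /setIP[/morphimP[x Nx Gx ->]] /normP nXx.
have nMX : X \subset 'N(M) := subset_trans sXP nMP.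
have defXM : X <*> M = X * M by rewrite norm_joinEl.
have sylX : p.-Sylow(X <*> M) X.
  rewrite /pHall joing_subl pX -divgS ?joing_subl //= defXM.
  by rewrite coprime_cardMg ?mulKn // (pnat_coprime pX).
have sylXx : p.-Sylow(X <*> M) (X :^ x).
  rewrite pHallE cardJg (card_Hall sylX) eqxx andbT.
  have nMXx : X :^ x \subset 'N(M) by rewrite -(normP Nx) normJ conjSg.
  by rewrite /= norm_joinEl //= (normC nMX) -quotientSK // quotientJ // nXx.
have [z] := Sylow_trans sylX sylXx; rewrite /= defXM => /mulsgP[u m Xu Mm ->] eX.
have NXxm : x * m^-1 \in 'N(X).
  by apply/normP; rewrite conjsgM eX -conjsgM mulgK conjGid.
rewrite -(coset_kerr x (groupVr Mm)).
have Nm := subsetP (normG M) m Mm.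
apply: mem_morphim; first by rewrite groupM ?groupV.
by rewrite inE NXxm andbT groupM ?groupV // (subsetP (normal_sub nMG)).
Qed.

Lemma Thompson_sub_id gT (P U : {group gT}) :
  U \subset P -> Thompson_sub P \subset U -> Thompson_sub P = Thompson_sub U.
Proof.
move=> sUP /Thompson_sub_subset sJU.
have [A0 maxA0 _] := max_abelian_exists (sub1G P) (abelian1 gT).
suff eqPU B : (B \in max_abelian P) = (B \in max_abelian U).
  by rewrite /Thompson_sub (eq_bigl _ _ eqPU).
apply/idP/idP=> maxB.
  have [_ cBB maxPB] := max_abelianP _ _ maxB; apply/max_abelianP; split=> //.
    exact: sJU.
  by move=> C sCU; apply: maxPB; apply: subset_trans sUP.
have [sBU cBB maxUB] := max_abelianP _ _ maxB; apply/max_abelianP; split=> //.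
  exact: subset_trans sUP.
have [_ cA0 maxPA] := max_abelianP _ _ maxA0.
move=> C sCP cCC; apply: leq_trans (maxPA C sCP cCC) _.
by apply: maxUB => //; apply: sJU.
Qed.

Hypothesis p_odd : odd p.

Section MinimalCounterexample.
Variables (gT : finGroupType) (G P : {group gT}).
Hypothesis sylP : p.-Sylow(G) P.
Hypothesis locG : Thompson_local G.
Hypothesis O_p'G : 'O_p^'(G) = 1.
Hypothesis nilGU : p_nilpotent p (G / 'O_p(G)).
Hypothesis nilH :
  forall H : {group gT}, P \subset H -> H \proper G -> p_nilpotent p H.

Lemma pcore_self_cent : 'C_G('O_p(G)) \subset 'O_p(G).
Proof.
set U := 'O_p(G); set C := 'C_G(U).
have nUG : U <| G := pcore_normal p G.
have nCG : C <| G by rewrite /normal subsetIl normsI ?normG ?norms_cent ?normal_norm.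
have nilC : p_nilpotent p C.
  apply: (@p_nilpotent_central _ _ (U :&: C)%G).
  - by rewrite /= subsetI subsetIr (subset_trans (subsetIl _ _)) // centsC subsetIr.
  - by apply: pgroupS (pcore_pgroup p G); apply: subsetIl.
  have nUC : C \subset 'N(U) := subset_trans (normal_sub nCG) (normal_norm nUG).
  apply: isog_p_nilpotent (second_isog nUC) _.
  by apply: p_nilpotentS nilGU; apply: quotientS; apply: normal_sub.
apply: (pcore_max _ nCG); apply: p_nilpotent_pgroup nilC _.
apply/trivgP; rewrite -O_p'G pcore_max ?pcore_pgroup //.
by rewrite gFnormal_trans.
Qed.

Lemma Sylow_maximal (H : {group gT}) :
  P \subset H -> H \proper G -> H :=: P.
Proof.
move=> sPH prH; have nil := nilH sPH prH; have sHG := proper_sub prH.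
have sUP : 'O_p(G) \subset P := pcore_sub_Hall sylP.
have nUH : 'O_p(G) <| H.
  by apply: normalS (pcore_normal _ _); rewrite ?(subset_trans sUP).
have sOU : 'O_p^'(H) \subset 'O_p(G).
  apply: subset_trans pcore_self_cent; rewrite subsetI.
  by rewrite (subset_trans (pcore_sub _ _)) // (p_nilpotent_cent nUH) ?pcore_pgroup.
have O1 : 'O_p^'(H) = 1.
  by rewrite -(setIidPr sOU); apply: TI_pcoreC.
exact: sub_pHall sylP (p_nilpotent_pgroup nil O1) sPH sHG.
Qed.

Lemma Thompson_p_complement_minimal : p_nilpotent p G.
Proof.
have [// | not_nil] := boolP (p_nilpotent p G).
set U := 'O_p(G)%G; set V := 'Z(U)%G.
have [sPG pP _] := and3P sylP.
have nUG : U <| G := pcore_normal p G.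
have sUP : U \subset P := pcore_sub_Hall sylP.
have nUP := subset_trans sPG (normal_norm nUG).
have nVG : V <| G by rewrite gFnormal_trans.
have sVU : V \subset U := center_sub U.
have cVV : abelian V := center_abelian U.
have cUV : U \subset 'C(V) by rewrite centsC subsetIr.
have cGV : 'C_G(V) \subset U.
  have sZV : 'Z(P) \subset V.
    rewrite subsetI; have cZU : 'Z(P) \subset 'C(U).
      by rewrite (subset_trans (subsetIr _ _)) // centS.
    rewrite cZU andbT; apply: subset_trans pcore_self_cent.
    by rewrite subsetI cZU andbT (subset_trans (center_sub P)).
  have defNZ : 'N_G('Z(P)) = P.
    apply: (@Sylow_maximal 'N_G('Z(P))%G); first by rewrite subsetI sPG gFnorm.
    rewrite properE subsetIl; apply: contra not_nil => sGN.
    exact: p_nilpotentS sGN (locG false sylP).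
  have nCG : 'C_G(V) <| G.
    by rewrite /normal subsetIl normsI ?normG ?norms_cent ?normal_norm.
  apply: (pcore_max _ nCG); apply: pgroupS pP; rewrite -defNZ setIS //.
  by rewrite (subset_trans (centS sZV)) ?cent_sub.
have memU z : z \in G -> z \in 'C(V) -> z \in U.
  by move=> Gz Cz; rewrite (subsetP cGV) // inE Gz.
have [A maxA [nsAU nAV]] : exists2 A : {group gT}, A \in max_abelian P &
    ~~ (A \subset U) /\ V \subset 'N(A).
  pose Q (A : {group gT}) := (A \in max_abelian P) && ~~ (A \subset U).
  have [A QA] : exists A, Q A.
    apply/existsP; apply: contraR not_nil => /existsPn nQ.
    have sJU : Thompson_sub P \subset U.
      apply/Thompson_sub_subset=> B maxB; have := nQ B.
      by rewrite /Q maxB /= negbK.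
    have := locG true sylP; rewrite /= (Thompson_sub_id sUP sJU).
    by apply: p_nilpotentS; rewrite subsetI subxx gFnorm_trans ?normal_norm.
  case: (@arg_maxnP _ A Q (fun B => #|B :&: V|) QA) => B /andP[maxB nsBU] maxBV.
  exists B => //; split=> //; apply: contraT => nBV.
  have nVP : V <| P by apply: normalS nVG; rewrite ?(subset_trans sVU).
  have [B' maxB' [ltB nB']] := Thompson_replacement pP maxB cVV nVP nBV.
  case/negP: nBV; apply: subset_trans nB'.
  have sB'U : B' \subset U.
    apply: contraLR (proper_card ltB) => nsB'U; rewrite -leqNgt; apply: maxBV.
    by rewrite /Q maxB'.
  have [sB'P cB'B' maxPB'] := max_abelianP _ _ maxB'.
  have cVB' : B' \subset 'C(V) := subset_trans sB'U cUV.
  have eB' : B' :=: V <*> B'.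
    apply/eqP; rewrite eqEcard joing_subr maxPB' ?join_subG ?(subset_trans sVU) //.
    by rewrite abelianY cVV cB'B'.
  by rewrite eB' joing_subl.
have [sAP cAA _] := max_abelianP _ _ maxA.
set Kb := 'O_p^'(G / U)%G; set Pb := (P / U)%G.
have sylPb : p.-Sylow(G / U) Pb := quotient_pHall nUP sylP.
have /sdprodP[_ defGb nKPb tiKPb] : Kb ><| Pb = G / U by apply/sdprod_Hall_p'coreP.
have nKG : Kb <| G / U := pcore_normal _ _.
have p'K : p^'.-group Kb := pcore_pgroup _ _.
have pPb : p.-group Pb := quotient_pgroup _ pP.
have ntK : Kb :!=: 1.
  apply: contraNneq not_nil => K1; apply: pgroup_p_nilpotent.
  rewrite -(pquotient_pgroup (pcore_pgroup p G) (normal_norm nUG)).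
  by rewrite -defGb K1 mul1g.
have minK (H : {group coset_of U}) :
    H \subset Kb -> Pb \subset 'N(H) -> H :=: 1 \/ H :=: Kb.
  move=> sHK nHP; have defHP : H <*> Pb = H * Pb by rewrite norm_joinEr.
  have sHPG : H <*> Pb \subset G / U.
    by rewrite join_subG -defGb mulG_subr (subset_trans sHK) ?mulG_subl.
  pose L := (coset U @*^-1 (H <*> Pb))%G.
  have defL : L / U = H <*> Pb by rewrite cosetpreK.
  have sPL : P \subset L.
    by rewrite -sub_morphim_pre //= -/(quotient P U) joing_subr.
  have sLG : L \subset G.
    have sUL : U \subset L := subset_trans sUP sPL.
    by rewrite -(quotientSGK _ (normal_sub nUG)) ?subsetIl // defL.
  have [eLG | neLG] := eqVneq (L : {set gT}) G.
    right; apply/eqP; rewrite eqEcard sHK -(leq_pmul2r (cardG_gt0 Pb)).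
    rewrite -!TI_cardMg ?(trivgP (subset_trans (setSI _ sHK) _)) ?tiKPb //.
    by rewrite -defHP -defL eLG defGb /=.
  left; have eLP : L :=: P by apply: Sylow_maximal; rewrite // properEneq neLG.
  apply/trivgP; rewrite -tiKPb subsetI sHK.
  apply: subset_trans (joing_subl H Pb) _.
  by rewrite -defL eLP.
have abK : abelian Kb.
  set r := pdiv #|Kb|.
  have r_pr : prime r by rewrite pdiv_prime // cardG_gt1.
  have coKP : coprime #|Kb| #|Pb| by rewrite coprime_sym (pnat_coprime pPb).
  have [R sylR nRP] := sol_coprime_Sylow_exists r (pgroup_sol pPb) nKPb coKP.
  have [sRK rR _] := and3P sylR.
  have eRK : R :=: Kb.
    have [R1|//] := minK R sRK nRP.
    have := card_Hall sylR; rewrite R1 cards1 => /esym/eqP.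
    by rewrite partn_eq1 ?cardG_gt0 // p'natE // pdiv_dvd.
  have rK : r.-group Kb by rewrite -eRK.
  have nDP : Pb \subset 'N(Kb^`(1)) by apply: gFnorm_trans.
  have [D1 | DK] := minK Kb^`(1)%G (der_sub 1 Kb) nDP; first exact/derG1P.
  have := sol_der1_proper (pgroup_sol rK) (subxx Kb) ntK.
  by rewrite (DK : Kb^`(1) = Kb) properxx.
have oddV : odd #|V|.
  by apply: odd_pgroup_odd p_odd (pgroupS _ pP); apply: subset_trans sUP.
have coVK : coprime #|V| #|Kb|.
  by apply: pnat_coprime p'K; apply: pgroupS pP; apply: subset_trans sUP.
have nUg z : z \in G -> z \in 'N(U) := subsetP (normal_norm nUG) z.
have nVg z : z \in G -> z \in 'N(V) := subsetP (normal_norm nVG) z.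
have cAK : A / U \subset 'C(Kb).
  apply/subsetP=> _ /morphimP[a Na Aa ->]; apply/centP=> xb Kxb.
  have Ga : a \in G := subsetP (subset_trans sAP sPG) a Aa.
  have /morphimP[x Nx Gx def_xb] := subsetP (normal_sub nKG) xb Kxb.
  have inU z : z \in G -> coset U z = 1 -> z \in 'C(V).
    by move=> Gz z1; apply: (subsetP cUV); apply: coset_idr z1; apply: nUg.
  have commK b : b \in G -> [~ x, x ^ b] \in 'C(V).
    move=> Gb; apply: inU; first by rewrite groupR ?groupJ.
    rewrite morphR ?groupJ ?nUg // morphJ ?nUg //= -def_xb.
    apply/eqP/commgP; apply: (centsP abK) => //.
    by rewrite memJ_norm // (subsetP (normal_norm nKG)) // mem_quotient.
  have xaV : [~ x, a] \in 'C(V).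
    apply: (quadratic_cent cVV oddV coVK) => //; try exact: nVg; last 2 first.
    - exact: commK.
    - by apply: commK; rewrite groupV.
    - move=> v Vv; apply/eqP/commgP.
      suff Ava : [~ v, a] \in A by apply: (centsP cAA).
      by rewrite commgEr groupM // memJ_norm ?groupV // (subsetP nAV).
    apply: inU; first exact: groupX.
    by rewrite morphX //= -def_xb; apply: expg_cardG.
  have Uxa := memU _ (groupR Gx Ga) xaV.
  by apply/commute_sym/commgP; rewrite def_xb -morphR //= coset_id.
have sAPb : A / U \subset Pb by apply: quotientS.
have nEG : 'C_Pb(Kb) <| G / U.
  have : Kb * Pb \subset 'N('C_Pb(Kb)).
    apply: mul_subG; first by apply: cents_norm; rewrite centsC; exact: subsetIr.
    by rewrite normsI ?normG ?norms_cent.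
  by rewrite defGb /normal subIset ?(pHall_sub sylPb).
have E1 : 'C_Pb(Kb) = 1.
  apply/trivgP; rewrite -(trivg_pcore_quotient p G) pcore_max //.
  by apply: pgroupS pPb; apply: subsetIl.
case/negP: nsAU; rewrite -quotient_sub1 ?(subset_trans sAP) //.
by rewrite -E1 subsetI sAPb.
Qed.
End MinimalCounterexample.

Lemma Thompson_local_pquotient gT (G U : {group gT}) :
    U <| G -> p.-group U ->
    (forall P X : {group gT}, p.-Sylow(G) P -> U \proper X -> X <| P ->
      p_nilpotent p 'N_G(X)) ->
    ~~ p.-Sylow(G) U ->
  Thompson_local (G / U).
Proof.
move=> nUG pU nilX nsylU b Pb sylPb; have nUG' := normal_norm nUG.
have [P defP sUP sPG] := inv_quotientS nUG (pHall_sub sylPb).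
have nUP : U <| P := normalS sUP sPG nUG.
have sylP : p.-Sylow(G) P.
  by rewrite -(pquotient_pHall pU nUG nUP) -defP.
have nFP : center_or_Thompson b _ Pb <| P / U by rewrite -defP gFnormal.
have [X defX sUX nXP] := inv_quotientN nUP nFP.
have nUX : U <| X := normalS sUX (subset_trans (normal_sub nXP) sPG) nUG.
have ltUX : U \proper X.
  rewrite properEneq sUX andbT; apply: contra nsylU => /eqP eUX.
  suff P1 : Pb :=: 1.
    suff -> : U :=: P by [].
    by apply/eqP; rewrite eqEsubset sUP -quotient_sub1 ?normal_norm // -defP P1 /=.
  apply: contraTeq isT => ntPb.
  have := center_or_Thompson_neq1 b (pHall_pgroup sylPb) ntPb.
  by rewrite defX -eUX trivg_quotient eqxx.
apply: p_nilpotentS (quotient_p_nilpotent _ (nilX P X sylP ltUX nXP)); last first.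
  by rewrite (subset_trans (subsetIl _ _)).
rewrite defX; apply/subsetP=> y /setIP[/morphimP[x Nx Gx ->]] /normP nXx.
apply: mem_morphim => //; rewrite inE Gx; apply/normP/eqP.
rewrite eqEcard cardJg leqnn andbT -(quotientSGK _ sUX).
  by rewrite quotientJ // nXx.
by rewrite -(normP Nx) normJ conjSg normal_norm.
Qed.

(* By Frobenius' theorem a counterexample has a [p]-subgroup [U] whose normalizer
   is not [p]-nilpotent; choosing [U] with first the [p]-part of [#|'N_G(U)|],
   then [#|U|], maximal forces [U] to be normal in [G]. *)
Theorem Thompson_p_complement gT (G : {group gT}) :
  Thompson_local G -> p_nilpotent p G.
Proof.
move: {2}#|G| (leqnn #|G|) => n; elim: n gT G => [|n IHn] gT G.
  by rewrite leqNgt cardG_gt0.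
rewrite leq_eqVlt => /predU1P[cG | ltGn]; last exact: IHn.
have {}IHn rT (H : {group rT}) : #|H| < #|G| -> Thompson_local H -> p_nilpotent p H.
  by rewrite cG ltnS; apply: IHn.
move=> locG; have [// | not_nil] := boolP (p_nilpotent p G).
pose Q (U : {group gT}) :=
  [&& U \subset G, p.-group U, U != 1%G & ~~ p_nilpotent p 'N_G(U)].
pose f (U : {group gT}) := (#|'N_G(U)|`_p * #|G|.+1 + #|U|)%N.
have [U0 QU0] : exists U, Q U.
  apply/existsP; apply: contraR not_nil => /existsPn nQ.
  apply: Frobenius_p_nilpotent => U sUG pU ntU; have := nQ U.
  by rewrite /Q sUG pU -val_eqE /= ntU negbK.
case: (@arg_maxnP _ U0 Q f QU0) => U /and4P[sUG pU ntU nilNU] maxU.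
rewrite -val_eqE /= in ntU.
have nil_big (X : {group gT}) :
  X \subset G -> p.-group X -> X :!=: 1 -> f U < f X -> p_nilpotent p 'N_G(X).
- move=> sXG pX ntX; apply: contraTT => nX; rewrite -leqNgt; apply: maxU.
  by rewrite /Q sXG pX nX -val_eqE /= ntX.
have ltf (X : {group gT}) : #|'N_G(U)|`_p < #|'N_G(X)|`_p -> f U < f X.
  move=> lt; rewrite /f; apply: leq_trans (leq_addr _ _).
  apply: leq_trans (leq_mul lt (leqnn _)); rewrite mulSn addnC ltn_add2r ltnS.
  exact: subset_leq_card.
have eN : 'N_G(U) = G.
  apply/eqP; apply: contraR nilNU => neNG.
  apply: IHn; first by rewrite proper_card // properEneq neNG subsetIl.
  move=> b S sylS; have [sSN pS _] := and3P sylS.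
  have [sSG nUS] := subsetIP sSN.
  suff nilS : p_nilpotent p 'N_G(center_or_Thompson b gT S).
    by apply: p_nilpotentS nilS; rewrite setSI ?subsetIl.
  have [sylSG | nsylS] := boolP (p.-Sylow(G) S); first exact: locG.
  have [P sylP sSP] := Sylow_superset sSG pS; have [sPG pP _] := and3P sylP.
  have ltSP : S \proper P.
    rewrite properEneq sSP andbT; apply: contra nsylS => /eqP eSP.
    by rewrite [gval S]eSP.
  have sUS : U \subset S.
    by apply: subset_trans (pcore_sub_Hall sylS); rewrite pcore_max // normalSG.
  have ntS : S :!=: 1 by apply: contraNneq ntU => S1; rewrite -subG1 -S1.
  apply: (nil_big (center_or_Thompson b gT S)%G) => /=.
  - by apply: subset_trans sSG; apply: gFsub.
  - by apply: pgroupS pS; apply: gFsub.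
  - exact: center_or_Thompson_neq1 pS ntS.
  apply: ltf; rewrite -(card_Hall sylS).
  apply: leq_trans (proper_card (nilpotent_proper_norm (pgroup_nil pP) ltSP)) _.
  have sNN : 'N_P(S) \subset 'N_G(center_or_Thompson b gT S).
    by rewrite setISS // gFnorms.
  have [R sylR sNR] := Sylow_superset sNN (pgroupS (subsetIl _ _) pP).
  by rewrite -(card_Hall sylR) subset_leq_card.
have nUG : U <| G by rewrite /normal sUG -{1}eN subsetIr.
have defU : U = 'O_p(G)%G.
  apply/eqP; rewrite -val_eqE eqEcard pcore_max //=.
  have sUO : U \subset 'O_p(G) by apply: pcore_max.
  have := maxU 'O_p(G)%G; rewrite /f /Q /= pcore_sub pcore_pgroup eN.
  have -> : 'N_G('O_p(G)) = G by apply/setIidPl; apply: gFnorm.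
  rewrite not_nil leq_add2l -val_eqE /=; apply.
  by rewrite andbT; apply: contraNneq ntU => O1; rewrite -subG1 -O1.
have nil_sup (P X : {group gT}) :
  p.-Sylow(G) P -> U \proper X -> X <| P -> p_nilpotent p 'N_G(X).
- move=> sylP ltUX nXP; have [sPG pP _] := and3P sylP.
  have [sXP nPX] := andP nXP; have sXG := subset_trans sXP sPG.
  apply: nil_big => //; first exact: pgroupS pP.
    by apply: contraNneq ntU => X1; rewrite -subG1 -X1 proper_sub.
  have sPN : P \subset 'N_G(X) by rewrite subsetI sPG.
  have [R sylR sPR] := Sylow_superset sPN pP.
  have le : #|'N_G(U)|`_p <= #|'N_G(X)|`_p.
    by rewrite eN -(card_Hall sylP) -(card_Hall sylR) subset_leq_card.
  by rewrite /f -addnS leq_add ?leq_mul ?proper_card.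
have nsylU : ~~ p.-Sylow(G) U.
  apply: contra not_nil => sylU; apply: p_nilpotentS (locG true U sylU).
  by rewrite subsetI subxx gFnorm_trans ?normal_norm.
have nilGU : p_nilpotent p (G / U).
  apply: IHn; first by rewrite ltn_quotient.
  exact: Thompson_local_pquotient.
have O_p'G : 'O_p^'(G) = 1.
  apply/eqP; apply: contraR not_nil => ntO.
  have nOG := pcore_normal p^' G; have p'O := pcore_pgroup p^' G.
  apply: (p_nilpotent_quotient_p' nOG p'O); apply: IHn; last exact: Thompson_local_quotient_p'.
  by rewrite ltn_quotient // pcore_sub.
have [P sylP] := Sylow_exists p G.
case/negP: not_nil; rewrite defU in nilGU.
apply: (Thompson_p_complement_minimal sylP) => // H sPH prH.
apply: IHn; first exact: proper_card.
move=> b S sylS; have sHG := proper_sub prH.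
apply: p_nilpotentS (locG b S _); first by rewrite setSI.
rewrite pHallE (subset_trans (pHall_sub sylS)) //= (card_Hall sylS).
by rewrite -(card_Hall (pHall_subl sPH sHG sylP)) (card_Hall sylP).
Qed.

End ThompsonPComplement.

(** * Fixed-point-free automorphisms of prime order *)

Section FixedPointFree.
Implicit Types gT : finGroupType.

Lemma prime_semiregular gT (K A : {group gT}) :
  prime #|A| -> 'C_K(A) = 1 -> semiregular K A.
Proof.
move=> prA cKA b /setD1P[ntb Ab].
have [sAb | tiAb] := prime_subgroupVti <[b]>%G prA.
  apply/trivgP; rewrite -cKA; apply: setIS.
  by apply: subset_trans (centS sAb); rewrite cent_cycle.
case/eqP: ntb; apply/set1P; rewrite -[[set 1]]tiAb inE cycle_id.
exact: Ab.
Qed.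

(* Summing [v ^ (b ^ x)] over [b] in [A] and [x] in [Q]: the inner sum over [b]
   is fixed by [A :^ x], and for [b != 1] the inner sum over [x] is fixed by [Q],
   so all that remains is [#|Q|] times [v]. *)
Lemma prime_regular_abelian gT (V Q A : {group gT}) :
    abelian V -> coprime #|V| #|Q| -> prime #|A| ->
    Q \subset 'N(V) -> A \subset 'N(V) -> A \subset 'N(Q) ->
    'C_V(Q) = 1 -> 'C_V(A) = 1 -> 'C_Q(A) = 1 -> V :=: 1.
Proof.
move=> abV coVQ prA nVQ nVA nQA cVQ cVA cQA; apply/trivgP/subsetP=> v Vv.
pose M := FiniteModule.fmod_of abV.
pose act (u : M) y : M := FiniteModule.actr u y.
have actM u y z : y \in 'N(V) -> z \in 'N(V) -> act u (y * z) = act (act u y) z.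
  by move=> Ny Nz; exact: FiniteModule.actrM.
have act_sum I (r : seq I) (P : pred I) (F : I -> M) y :
    act (\sum_(i <- r | P i) F i)%R y = (\sum_(i <- r | P i) act (F i) y)%R.
  by apply: (big_morph (act^~ y)); [exact: FiniteModule.actAr | exact: FiniteModule.act0r].
have fix0 (B : {group gT}) (u : M) :
    B \subset 'N(V) -> 'C_V(B) = 1 -> {in B, forall b, act u b = u} -> u = 0%R.
  move=> nVB cVB fixu; apply: FiniteModule.fmod_inj.
  rewrite FiniteModule.fmval0; apply/set1P; rewrite -[[set 1]]cVB inE FiniteModule.fmodP /=.
  apply/centP=> b Bb; apply/commgP; rewrite -conjg_fix.
  by rewrite -FiniteModule.fmvalJ ?(subsetP nVB) //= [FiniteModule.actr _ _]fixu.
set u : M := FiniteModule.fmod abV v.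
have sumA x : x \in Q -> (\sum_(b in A) act u (b ^ x) = 0)%R.
  move=> Qx; have Nx := subsetP nVQ x Qx.
  have nVAx : A :^ x \subset 'N(V) by rewrite -(normP Nx) normJ conjSg.
  apply: (fix0 (A :^ x)%G) => //.
    by rewrite -{1}(normP Nx) centJ -conjIg cVA conjs1g.
  move=> _ /imsetP[a Aa ->]; rewrite act_sum [RHS](reindex_inj (mulIg a)) /=.
  apply: eq_big => [b | b Ab]; first by rewrite groupMr.
  by rewrite conjMg [RHS]actM ?(subsetP nVAx) ?memJ_conjg.
have sumQ b : b \in A^# -> (\sum_(x in Q) act u (b ^ x) = 0)%R.
  move=> Ab'; have [ntb Ab] := setD1P Ab'; have Nb := subsetP nVA b Ab.
  have cQb := prime_semiregular prA cQA Ab'.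
  have comQ x : x \in Q -> [~ b, x] \in Q.
    by move=> Qx; rewrite commgEr groupM // memJ_norm ?groupV // (subsetP nQA).
  have inj : {in Q &, injective (fun x => [~ b, x])}.
    move=> x y Qx Qy; rewrite !commgEl => /mulgI exy.
    apply/eqP; rewrite eq_mulgV1; apply/eqP/set1P; rewrite -[[set 1]]cQb inE groupM ?groupV //=.
    by apply/cent1P/commute_sym/commgP; rewrite -conjg_fix conjgM exy conjgK.
  have imQ : [set [~ b, x] | x in Q] = Q.
    apply/eqP; rewrite eqEcard card_in_imset // leqnn andbT.
    by apply/subsetP=> _ /imsetP[x Qx ->]; apply: comQ.
  have -> : (\sum_(x in Q) act u (b ^ x) = \sum_(y in Q) act (act u b) y)%R.
    rewrite -[in RHS]imQ big_imset //=; apply: eq_bigr => x Qx.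
    by rewrite -[RHS](actM u b) ?Nb ?(subsetP nVQ _ (comQ _ Qx)) // commgEl mulKVg.
  apply: (fix0 Q) => // z Qz; rewrite act_sum [RHS](reindex_inj (mulIg z)) /=.
  apply: eq_big => [x | x Qx]; first by rewrite groupMr.
  by rewrite [RHS]actM ?(subsetP nVQ).
have : (\sum_(x in Q) \sum_(b in A) act u (b ^ x) = 0)%R by apply: big1.
have sum1 : (\sum_(b in A | b != 1%g) \sum_(x in Q) act u (b ^ x) = 0)%R.
  by apply: big1 => b /andP[Ab ntb]; apply: sumQ; rewrite !inE ntb.
rewrite exchange_big /= (bigD1 1) //= sum1.
under eq_bigr do rewrite conj1g /act FiniteModule.actr1.
rewrite GRing.addr0 GRing.sumr_const => /(congr1 (@FiniteModule.fmval _ _ abV)).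
rewrite FiniteModule.fmvalZ FiniteModule.fmval0 FiniteModule.fmodK // => vQ.
by rewrite -(expgK coVQ Vv) vQ expg1n set11.
Qed.

Lemma Sylow_normal_nilpotent gT (G : {group gT}) :
    (forall s, prime s -> exists2 S : {group gT}, s.-Sylow(G) S & S <| G) ->
  nilpotent G.
Proof.
move=> nG; suff <- : 'F(G) = G by apply: Fitting_nil.
apply/eqP; rewrite eqEsubset Fitting_sub -{1}(Sylow_gen G) gen_subG.
apply/bigcupsP=> P /SylowP[s s_pr sylP]; have [S sylS nSG] := nG s s_pr.
have [x Gx ->] := Sylow_trans sylS sylP; rewrite (normP (subsetP (normal_norm nSG) x Gx)).
exact/Fitting_max/(pgroup_nil (pHall_pgroup sylS)).
Qed.

Lemma sol_pcore_neq1 gT (G : {group gT}) :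
  solvable G -> G :!=: 1 -> exists2 r, prime r & 'O_r(G) != 1.
Proof.
move=> solG ntG; have [F1 | [r r_pr dvr]] := trivgVpdiv 'F(G).
  by case/eqP: ntG; apply/eqP; rewrite -(trivg_Fitting solG) F1.
exists r => //; rewrite -p_core_Fitting.
apply: contraTneq dvr => O1.
have := card_Hall (nilpotent_pcore_Hall r (Fitting_nil G)).
by rewrite /= O1 cards1 => /esym/eqP; rewrite partn_eq1 // p'natE.
Qed.

Section Induction.
Variables (gT : finGroupType) (G A : {group gT}).
Hypotheses (prA : prime #|A|) (nGA : A \subset 'N(G)) (cGA : 'C_G(A) = 1).
Hypothesis nil_sub : forall H : {group gT},
  H \proper G -> A \subset 'N(H) -> nilpotent H.
Hypothesis nil_quo : forall N : {group gT},
  N <| G -> N :!=: 1 -> A \subset 'N(N) -> nilpotent (G / N).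

Let coGA : coprime #|G| #|A|.
Proof. exact: regular_norm_coprime nGA (prime_semiregular prA cGA). Qed.

Let solA : solvable A.
Proof. by apply/abelian_sol/cyclic_abelian/prime_cyclic. Qed.

Lemma sol_prime_regular_nilpotent : solvable G -> nilpotent G.
Proof.
move=> solG; have [-> | ntG] := eqVneq (G : {set gT}) 1; first exact: nilpotent1.
have [r r_pr ntO] := sol_pcore_neq1 solG ntG.
set V := 'Z('O_r(G))%G.
have rO := pcore_pgroup r G.
have ntV : V :!=: 1 by apply: contra_neq ntO => /(trivg_center_pgroup rO).
have sVO : V \subset 'O_r(G) := center_sub _.
have nVG : V <| G by rewrite gFnormal_trans ?pcore_normal.
have nVA : A \subset 'N(V) by do 2!apply: gFnorm_trans.
have rV : r.-group V := pgroupS sVO rO.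
have abV : abelian V := center_abelian _.
have nilGV := nil_quo nVG ntV nVA.
have cVA : 'C_V(A) = 1.
  by apply/trivgP; rewrite -cGA setSI // (subset_trans sVO) ?pcore_sub.
apply: Sylow_normal_nilpotent => s s_pr; have [-> | nesr] := eqVneq s r.
  exists 'O_r(G)%G; last exact: pcore_normal.
  have := nilpotent_pcore_Hall r nilGV; rewrite (pquotient_pcore nVG rV).
  by rewrite pquotient_pHall // (normalS sVO (pcore_sub r G) nVG).
have [Q sylQ nQA] := sol_coprime_Sylow_exists s solA nGA coGA.
have [sQG sQ _] := and3P sylQ; exists Q => //.
have nVQ := subset_trans sQG (normal_norm nVG).
have coVQ : coprime #|V| #|Q|.
  rewrite coprime_sym (pnat_coprime sQ) // (pi_pnat rV) //.
  by rewrite !inE eq_sym.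
have cVQ : Q \subset 'C(V).
  have sWV : [~: V, Q] \subset V by rewrite commg_subl.
  rewrite centsC; apply/commG1P.
  apply: (@prime_regular_abelian _ [~: V, Q]%G Q A) => //.
  - exact: abelianS abV.
  - by rewrite (coprimeSg sWV).
  - exact: commg_normr.
  - exact: normsR.
  - exact: coprime_abel_cent_TI.
  - by apply/trivgP; rewrite -cVA setSI.
  - by apply/trivgP; rewrite -cGA setSI.
have defVQ : V <*> Q = V * Q by rewrite norm_joinEr.
have nVQG : V <*> Q <| G.
  rewrite -(quotientGK nVG) defVQ -(quotientK nVQ) cosetpre_normal.
  have hQ : s.-Sylow(G / V) (Q / V) by apply: quotient_pHall.
  by rewrite (nilpotent_Hall_pcore nilGV hQ) pcore_normal.
have nQVQ : Q <| V <*> Q.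
  by rewrite normalYr cents_norm // centsC.
have hQ : s.-Hall(V <*> Q) Q.
  by apply: pHall_subl sylQ; rewrite ?joing_subr ?normal_sub.
by rewrite -(normal_Hall_pcore hQ nQVQ) gFnormal_trans.
Qed.

Lemma prime_regular_sol : solvable G.
Proof.
have [pG2 | ] := boolP (2.-group G); first exact/pgroup_sol/pG2.
have solQ (N : {group gT}) :
  N <| G -> N :!=: 1 -> A \subset 'N(N) -> solvable N -> solvable G.
- move=> nNG ntN nNA solN; rewrite (series_sol nNG) solN /=.
  exact/nilpotent_sol/nil_quo.
rewrite /pgroup /pnat cardG_gt0 /= => /allPn[p]; rewrite mem_primes => /and3P[p_pr _ pG] pn2.
have p_odd : odd p by case: (even_prime p_pr) => // p2; case/negP: pn2; rewrite p2.
have [P sylP nPA] := sol_coprime_Sylow_exists p solA nGA coGA.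
have [sPG pP _] := and3P sylP.
have ntP : P :!=: 1.
  apply: contraTneq pG => P1; have := card_Hall sylP; rewrite P1 cards1.
  by move=> /esym/eqP; rewrite partn_eq1 // p'natE.
have [/existsP[b /eqP nFG] | /existsPn nFG] :=
    boolP [exists b, 'N_G(center_or_Thompson b gT P) == G].
  have sFP : center_or_Thompson b gT P \subset P by apply: gFsub.
  apply: (solQ (center_or_Thompson b gT P)%G) => /=.
  - by rewrite /normal (subset_trans sFP) //= -{1}nFG subsetIr.
  - exact: center_or_Thompson_neq1 pP ntP.
  - exact: gFnorm_trans.
  exact: solvableS sFP (pgroup_sol pP).
have locG : Thompson_local p G.
  move=> b P1 sylP1; have [x Gx defP1] := Sylow_trans sylP sylP1.
  have nilN : p_nilpotent p 'N_G(center_or_Thompson b gT P).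
    apply/nilpotent_p_nilpotent/nil_sub; first by rewrite properEneq nFG subsetIl.
    by rewrite normsI // norms_norm // gFnorm_trans.
  have -> : center_or_Thompson b gT P1 = center_or_Thompson b gT P :^ x.
    have -> : P1 = (conjgm P x @* P)%G by apply/val_inj; rewrite /= morphim_conj setIid.
    by rewrite -injmF ?injm_conj // morphim_conj (setIidPr (gFsub _ _)).
  rewrite normJ -{1}(conjGid Gx) -conjIg.
  apply: isog_p_nilpotent nilN; rewrite isog_sym.
  exact: (conj_isog 'N_G(center_or_Thompson b gT P) x).
have nilG := Thompson_p_complement p_odd locG.
have nOA : A \subset 'N('O_p^'(G)) by apply: gFnorm_trans.
have [O1 | ntO] := eqVneq 'O_p^'(G) 1.
  exact: pgroup_sol (p_nilpotent_pgroup nilG O1).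
apply: (solQ 'O_p^'(G)%G) => //; first exact: pcore_normal.
apply/nilpotent_sol/nil_sub => //.
rewrite properEneq pcore_sub andbT; apply: contraTneq pG => eOG.
by rewrite -p'natE // -[pnat _ _]/(p^'.-group G) -eOG pcore_pgroup.
Qed.
End Induction.

Theorem prime_regular_nilpotent gT (G A : {group gT}) :
  prime #|A| -> A \subset 'N(G) -> 'C_G(A) = 1 -> nilpotent G.
Proof.
move: {2}#|G| (leqnn #|G|) => n; elim: n gT G A => [|n IHn] gT G A.
  by rewrite leqNgt cardG_gt0.
move=> leGn prA nGA cGA.
have coGA : coprime #|G| #|A|.
  exact: regular_norm_coprime nGA (prime_semiregular prA cGA).
have nil_sub (H : {group gT}) : H \proper G -> A \subset 'N(H) -> nilpotent H.
  move=> prH nHA; apply: IHn prA nHA _.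
    by rewrite -ltnS (leq_trans (proper_card prH)).
  by apply/trivgP; rewrite -cGA setSI ?proper_sub.
have nil_quo (N : {group gT}) :
  N <| G -> N :!=: 1 -> A \subset 'N(N) -> nilpotent (G / N).
- move=> nNG ntN nNA; have sNG := normal_sub nNG.
  have cGNA : 'C_(G / N)(A / N) = 1.
    rewrite -(@strongest_coprime_quotient_cent _ A G N) //.
    + by rewrite /= cGA quotient1.
    + by rewrite subIset ?sNG.
    + by rewrite (coprimeSg _ coGA) // subIset ?sNG.
    by rewrite (abelian_sol (cyclic_abelian (prime_cyclic prA))) orbT.
  have [AN1 | ntAN] := eqVneq (A / N) 1.
    by move: cGNA; rewrite AN1 cent1T setIT => ->; apply: nilpotent1.
  apply: (IHn _ _ (A / N)%G) => //.
  - by rewrite -ltnS (leq_trans (ltn_quotient ntN sNG)).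
  - have [_ /(_ _ (dvdn_quotient A N))/pred2P[]] := primeP prA => [/card1_trivg AN1|-> //].
    by rewrite AN1 eqxx in ntAN.
  exact: quotient_norms.
have solG := prime_regular_sol prA nGA cGA nil_sub nil_quo.
exact: sol_prime_regular_nilpotent prA nGA cGA nil_quo solG.
Qed.

End FixedPointFree.

(** * The diagonal action *)

Lemma simple_Aut_fixed_point (gT : finGroupType) (T : {group gT}) (a : {perm gT}) (p : nat) :
    simple T -> ~~ abelian T -> a \in Aut T -> prime p -> a ^+ p = 1 ->
  exists t, [/\ t \in T, t != 1 & a t = t].
Proof.
move=> simT nabT Aa p_pr ap.
have [a1 | nta] := eqVneq a 1.
  have /trivgPn[t Tt ntt] : T :!=: 1 by apply: contraNneq nabT => ->; apply: abelian1.
  by exists t; rewrite a1 perm1.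
have oa : #[a] = p by apply: nt_prime_order.
pose to := [Aut T]%gact.
pose G := (sdpair1 to @* T)%G; pose A := (sdpair2 to @* <[a]>)%G.
have sA : <[a]> \subset Aut T by rewrite cycle_subG.
have prA : prime #|A| by rewrite card_injm ?injm_sdpair2 // -orderE oa.
have nGA : A \subset 'N(G) by apply: subset_trans (im_sdpair_norm to); apply: morphimS.
have [t Tt [ntt cta]] : exists2 t, t \in T & t != 1 /\ sdpair1 to t \in 'C(A).
  have [cGA | /trivgPn[y /setIP[/morphimP[t Tt _ ->] Ct] nt]] := eqVneq 'C_G(A) 1; last first.
    by exists t => //; split=> //; apply: contraNneq nt => ->; rewrite morph1.
  case/negP: nabT; have := prime_regular_nilpotent prA nGA cGA.
  rewrite /= injm_nil ?injm_sdpair1 // => nilT.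
  exact/cyclic_abelian/prime_cyclic/(simple_sol_prime (nilpotent_sol nilT) simT).
exists t; split=> //.
have fix_t : sdpair1 to (a t) = sdpair1 to t.
  have -> : sdpair1 to (a t) = sdpair1 to t ^ sdpair2 to a := sdpair_act to Tt Aa.
  have A_a : sdpair2 to a \in A by rewrite mem_morphim ?cycle_id.
  by rewrite conjgE (centP cta _ A_a) mulKg.
by apply: (injmP (injm_sdpair1 to)) fix_t => //; rewrite Aut_closed.
Qed.

Section Diagonal.
Variables (gT : finGroupType) (T : {group gT}) (k : nat).
Local Notation tup := (SDtup k gT).
Local Notation N := (SDN k T).
Local Notation pt := (SDpt k T).
Implicit Types (x y n : tup) (s : 'S_k) (a : {perm gT}) (w : pt) (g h : {perm pt}).

Lemma SDNP x : reflect (forall i, x i \in T) (x \in N).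
Proof. by rewrite inE; apply: forallP. Qed.

Lemma SDcoset_eqP x y :
  reflect (exists2 d, d \in T & forall i, y i = d * x i) (SDcoset T x == SDcoset T y).
Proof.
apply: (iffP eqP) => [eq_xy | [d Td def_y]].
  have : y \in SDcoset T y.
    by apply/imsetP; exists 1; rewrite ?group1 //; apply/ffunP=> i; rewrite ffunE mul1g.
  by rewrite -eq_xy => /imsetP[d Td ->]; exists d => // i; rewrite ffunE.
apply/setP=> z; apply/imsetP/imsetP=> -[t Tt ->].
  exists (t * d^-1); rewrite ?groupM ?groupV //.
  by apply/ffunP=> i; rewrite !ffunE def_y mulgA mulgKV.
exists (t * d); rewrite ?groupM //.
by apply/ffunP=> i; rewrite !ffunE def_y mulgA.
Qed.

Lemma SDptP w : exists2 x, x \in N & val w = SDcoset T x.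
Proof. by case: w => S /= /imsetP[x Nx ->]; exists x. Qed.

Lemma SDpt_exists x : x \in N -> exists w : pt, val w = SDcoset T x.
Proof.
move=> Nx; have Ox : SDcoset T x \in SDOmega k T by apply: imset_f.
by exists (exist (fun S => S \in SDOmega k T) _ Ox).
Qed.

Lemma SDrmul_coset n x : SDrmul n (SDcoset T x) = SDcoset T [ffun i => x i * n i].
Proof.
rewrite /SDrmul /SDcoset -imset_comp; apply: eq_imset => t /=.
by apply/ffunP=> i; rewrite !ffunE mulgA.
Qed.

Lemma SDsym_coset s x : SDsym s (SDcoset T x) = SDcoset T [ffun i => x (s^-1 i)].
Proof.
rewrite /SDsym /SDcoset -imset_comp; apply: eq_imset => t /=.
by apply/ffunP=> i; rewrite !ffunE.
Qed.

Lemma SDaut_coset a x :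
  a \in Aut T -> x \in N -> SDaut a (SDcoset T x) = SDcoset T [ffun i => a (x i)].
Proof.
move=> Aa /SDNP Nx; rewrite /SDaut /SDcoset -imset_comp -[in RHS](im_autm Aa).
rewrite morphimEdom -imset_comp; apply: eq_in_imset => t Tt /=.
by apply/ffunP=> i; rewrite !ffunE -(autmE Aa) morphM.
Qed.

Lemma SDrmulN n x : n \in N -> x \in N -> [ffun i => x i * n i] \in N.
Proof. by move=> /SDNP Nn /SDNP Nx; apply/SDNP=> i; rewrite ffunE groupM. Qed.

Lemma SDsymN s x : x \in N -> [ffun i => x (s^-1 i)] \in N.
Proof. by move=> /SDNP Nx; apply/SDNP=> i; rewrite ffunE. Qed.

Lemma SDperm_exists (F : {set tup} -> {set tup}) (f : tup -> tup) :
    injective F -> (forall x, x \in N -> f x \in N) ->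
    (forall x, x \in N -> F (SDcoset T x) = SDcoset T (f x)) ->
  exists g, forall w, val (g w) = F (val w).
Proof.
move=> injF Nf Ff.
have FO w : F (val w) \in SDOmega k T.
  by have [x Nx ->] := SDptP w; rewrite Ff // imset_f ?Nf.
have injf : injective (fun w : pt => exist (fun S => S \in SDOmega k T) _ (FO w) : pt).
  by move=> w1 w2 /(congr1 val) /= /injF /val_inj.
by exists (perm injf) => w; rewrite permE.
Qed.

Lemma SDrmul_inj n : injective (SDrmul n).
Proof.
apply: imset_inj => x y /ffunP exy; apply/ffunP=> i.
by have := exy i; rewrite !ffunE => /mulIg.
Qed.

Lemma SDsym_inj s : injective (@SDsym k gT s).
Proof.
apply: imset_inj => x y /ffunP exy; apply/ffunP=> i.
by have := exy (s i); rewrite !ffunE permK.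
Qed.

(* [affine g n s a]: [g] maps the coset of [x] to that of the tuple with
   coordinates [a (x (s^-1 i)) * n i]; the elements of W are of this form. *)
Definition affine g n s a :=
  [/\ n \in N, a \in Aut T & forall w x, x \in N -> val w = SDcoset T x ->
      val (g w) = SDcoset T [ffun i => a (x (s^-1 i)) * n i]].

Definition linear g s a :=
  a \in Aut T /\ forall w x, x \in N -> val w = SDcoset T x ->
      val (g w) = SDcoset T [ffun i => a (x (s^-1 i))].

Definition one_tup : tup := [ffun=> 1].

Lemma one_tupN : one_tup \in N.
Proof. by apply/SDNP=> i; rewrite ffunE. Qed.

Lemma affineN n s a x :
  n \in N -> a \in Aut T -> x \in N -> [ffun i => a (x (s^-1 i)) * n i] \in N.
Proof.
move=> /SDNP Nn Aa /SDNP Nx; apply/SDNP=> i.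
by rewrite ffunE groupM ?Aut_closed.
Qed.

Lemma affine_SDW g : g \in SDW k T -> exists n s a, affine g n s a.
Proof.
case/gen_prodgP=> m [c gen_c ->]; elim: m c gen_c => [|m IHm] c gen_c.
  exists one_tup, 1, 1; rewrite big_ord0; split; rewrite ?one_tupN ?group1 //.
  move=> w x Nx def_w; rewrite perm1 def_w; congr SDcoset; apply/ffunP=> i.
  by rewrite /one_tup !ffunE invg1 !perm1 mulg1.
rewrite big_ord_recr /=; set g1 := \prod_(_ < _) _; set g2 := c _.
have [|n1 [s1 [a1 [Nn1 Aa1 def_g1]]]] := IHm (fun i => c (widen_ord (leqnSn m) i)).
  by move=> i; apply: gen_c.
have [n2 [s2 [a2 [Nn2 Aa2 def_g2]]]] : exists n s a, affine g2 n s a.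
  have := gen_c ord_max; rewrite -/g2 inE.
  case/orP=> [/orP[/exists_inP[n Nn] | /existsP[s]] | /exists_inP[a Aa]] /forallP def_g2.
  - exists n, 1, 1; split; rewrite ?group1 // => w x Nx def_w.
    rewrite (eqP (def_g2 w)) def_w SDrmul_coset; congr SDcoset; apply/ffunP=> i.
    by rewrite !ffunE invg1 !perm1.
  - exists one_tup, s, 1; split; rewrite ?group1 ?one_tupN // => w x Nx def_w.
    rewrite (eqP (def_g2 w)) def_w SDsym_coset; congr SDcoset; apply/ffunP=> i.
    by rewrite /one_tup !ffunE perm1 mulg1.
  exists one_tup, 1, a; split; rewrite ?one_tupN // => w x Nx def_w.
  rewrite (eqP (def_g2 w)) def_w SDaut_coset //; congr SDcoset; apply/ffunP=> i.
  by rewrite /one_tup !ffunE invg1 perm1 mulg1.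
exists [ffun i => a2 (n1 (s2^-1 i)) * n2 i], (s1 * s2), (a1 * a2).
split; first exact: affineN.
  exact: groupM.
move=> w x Nx def_w; rewrite permM.
set y : tup := [ffun i => a1 (x (s1^-1 i)) * n1 i].
have Ny : y \in N by apply: affineN.
rewrite (def_g2 _ y Ny (def_g1 w x Nx def_w)); congr SDcoset; apply/ffunP=> i.
rewrite !ffunE -(autmE Aa2) morphM ?autmE ?Aut_closed // ?(SDNP _ Nx) ?(SDNP _ Nn1) //.
by rewrite !permM invMg permM mulgA.
Qed.

Lemma linear1 : linear 1 1 1.
Proof.
split=> [|w x Nx def_w]; first exact: group1.
by rewrite perm1 def_w; congr SDcoset; apply/ffunP=> i; rewrite ffunE invg1 !perm1.
Qed.

Lemma linearM g1 g2 s1 s2 a1 a2 :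
  linear g1 s1 a1 -> linear g2 s2 a2 -> linear (g1 * g2) (s1 * s2) (a1 * a2).
Proof.
move=> [Aa1 def_g1] [Aa2 def_g2]; split=> [|w x Nx def_w]; first exact: groupM.
have Ny : [ffun i => a1 (x (s1^-1 i))] \in N.
  by apply/SDNP=> i; rewrite ffunE Aut_closed ?(SDNP _ Nx).
rewrite permM (def_g2 _ _ Ny (def_g1 w x Nx def_w)).
by congr SDcoset; apply/ffunP=> i; rewrite !ffunE permM invMg permM.
Qed.

Lemma linearX g s a m : linear g s a -> linear (g ^+ m) (s ^+ m) (a ^+ m).
Proof.
move=> lin_g; elim: m => [|m IHm]; first exact: linear1.
by rewrite !expgS; apply: linearM.
Qed.

Lemma linear_id g : linear g 1 1 -> g = 1.
Proof.
move=> [_ def_g]; apply/permP=> w; apply: val_inj; have [x Nx def_w] := SDptP w.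
rewrite (def_g w x Nx def_w) perm1 def_w; congr SDcoset.
by apply/ffunP=> i; rewrite ffunE invg1 !perm1.
Qed.

Definition single_tup (j : 'I_k) t : tup := [ffun i => if i == j then t else 1].

Lemma single_tupN j t : t \in T -> single_tup j t \in N.
Proof. by move=> Tt; apply/SDNP=> i; rewrite ffunE; case: ifP. Qed.

Lemma linear_faithful s a :
  ~~ abelian T -> 1 < k -> linear 1 s a -> s = 1 /\ a = 1.
Proof.
move=> nabT k_gt1 [Aa def_1].
have fixD x : x \in N -> exists2 d, d \in T & forall i, a (x (s^-1 i)) = d * x i.
  move=> Nx; have [w def_w] := SDpt_exists Nx.
  have := def_1 w x Nx def_w; rewrite perm1 def_w => /eqP/SDcoset_eqP[d Td def_x].
  by exists d => // i; rewrite -def_x ffunE.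
have a1 : a 1 = 1 by rewrite -(autmE Aa) morph1.
have s1 : s = 1.
  apply/permP=> j; rewrite perm1; apply: contraNeq nabT => ne_sj.
  have inv t : t \in T -> a t = t^-1.
    move=> Tt; have [d Td def_d] := fixD _ (single_tupN j Tt).
    have := def_d j; have := def_d (s j).
    have ne_s'j : s^-1 j != j by apply: contraNneq ne_sj => e; rewrite -{1}e permKV.
    rewrite !ffunE permK eqxx (negPf ne_sj) (negPf ne_s'j) a1 mulg1 => -> dt1.
    by apply: (mulIg t); rewrite mulVg.
  apply/centsP=> t Tt u Tu; apply: invg_inj.
  rewrite [in RHS]invMg -!inv ?groupM // -!(autmE Aa) morphM //.
split=> //; apply/permP=> t; rewrite perm1.
have [Tt | nTt] := boolP (t \in T); last exact: out_Aut Aa nTt.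
pose i0 := Ordinal (ltnW k_gt1); pose i1 := Ordinal k_gt1.
have [d Td def_d] := fixD _ (single_tupN i0 Tt).
have := def_d i1; rewrite s1 invg1 !ffunE !perm1 /= a1 mulg1 => d1.
by have := def_d i0; rewrite s1 invg1 !ffunE !perm1 /= -d1 mul1g.
Qed.

Lemma affine_linear g n s a w0 :
    affine g n s a -> val w0 = SDcoset T one_tup -> g w0 = w0 ->
  exists b, linear g s b.
Proof.
move=> [Nn Aa def_g] def_w0 gw0.
have := def_g w0 one_tup one_tupN def_w0; rewrite gw0 def_w0.
move/eqP/SDcoset_eqP=> [d Td def_n].
have n_d i : n i = d.
  have := def_n i; rewrite !ffunE mulg1 => <-.
  by rewrite -(autmE Aa) morph1 mul1g.
exists (a * conj_aut T d); split.
  by rewrite groupM // Aut_aut.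
move=> w x Nx def_w; rewrite (def_g w x Nx def_w); apply/eqP/SDcoset_eqP.
exists d^-1; rewrite ?groupV // => i; rewrite !ffunE permM n_d.
by rewrite norm_conj_autE ?(subsetP (normG T)) ?Aut_closed ?(SDNP _ Nx).
Qed.

Lemma translation_exists x w0 : x \in N -> val w0 = SDcoset T one_tup ->
  exists2 r, r \in SDW k T & val (r w0) = SDcoset T x.
Proof.
move=> Nx def_w0.
have [g def_g] := @SDperm_exists (SDrmul x) (fun y => [ffun i => y i * x i])
  (@SDrmul_inj x) (fun y => @SDrmulN x y Nx) (fun y _ => SDrmul_coset x y).
exists g.
  apply: mem_gen; rewrite inE; apply/orP; left; apply/orP; left.
  by apply/exists_inP; exists x => //; apply/forallP=> w; rewrite def_g.
rewrite def_g def_w0 SDrmul_coset; congr SDcoset; apply/ffunP=> i.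
by rewrite !ffunE mul1g.
Qed.

Lemma SDSym_linear g : reflect (exists s, linear g s 1) (g \in SDSym k T).
Proof.
rewrite inE; apply: (iffP existsP) => [[s /forallP def_g] | [s [_ def_g]]]; exists s.
  split=> [|w x Nx def_w]; first exact: group1.
  rewrite (eqP (def_g w)) def_w SDsym_coset; congr SDcoset.
  by apply/ffunP=> i; rewrite !ffunE perm1.
apply/forallP=> w; have [x Nx def_w] := SDptP w.
rewrite (def_g w x Nx def_w) def_w SDsym_coset; apply/eqP; congr SDcoset.
by apply/ffunP=> i; rewrite !ffunE perm1.
Qed.

Lemma linear_exists s : exists g, linear g s 1.
Proof.
have [g def_g] := @SDperm_exists (@SDsym k gT s) (fun y => [ffun i => y (s^-1 i)])
  (@SDsym_inj s) (@SDsymN s) (fun y _ => SDsym_coset s y).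
exists g; split=> [|w x Nx def_w]; first exact: group1.
rewrite def_g def_w SDsym_coset; congr SDcoset.
by apply/ffunP=> i; rewrite !ffunE perm1.
Qed.

Lemma SDSym_SDW g : g \in SDSym k T -> g \in SDW k T.
Proof.
rewrite inE => sym_g; apply: mem_gen.
by rewrite inE; apply/orP; left; apply/orP; right.
Qed.

Lemma unique_fixed_const g s a w0 x d :
    linear g s a -> val w0 = SDcoset T one_tup -> (forall w, g w = w -> w = w0) ->
    x \in N -> d \in T -> (forall i, a (x (s^-1 i)) = d * x i) ->
  forall i j, x i = x j.
Proof.
move=> [Aa def_g] def_w0 uniq_w0 Nx Td fix_x i j.
have [w def_w] := SDpt_exists Nx.
have gw : g w = w.
  apply: val_inj; rewrite (def_g w x Nx def_w) def_w; apply/eqP.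
  by rewrite eq_sym; apply/SDcoset_eqP; exists d => // l; rewrite ffunE.
have := def_w; rewrite (uniq_w0 w gw) def_w0 => /eqP/SDcoset_eqP[e Te def_x].
by rewrite !def_x !ffunE.
Qed.

Lemma prime_perm_transitive s p (i0 : 'I_k) :
    prime p -> s ^+ p = 1 -> s i0 != i0 -> (forall i, i \in porbit s i0) ->
  k = p.
Proof.
move=> p_pr sp s_i0 all_i0.
have nts : s != 1 by apply: contraNneq s_i0 => ->; rewrite perm1.
have cardO : #|porbit s i0| = k.
  by rewrite -[RHS]card_ord; apply: eq_card => i; rewrite all_i0.
have := dvdn_orbit 'P%act <[s]> i0; rewrite -orderE (nt_prime_order p_pr sp nts).
rewrite -porbitE cardO.
have [_ dvp] := primeP p_pr => /dvp/pred2P[k1|//].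
case/eqP: s_i0; apply: val_inj; move: i0 (s i0) {all_i0 cardO} => [m m_lt] [m' m'_lt] /=.
by move: m_lt m'_lt; rewrite k1 !ltnS !leqn0 => /eqP-> /eqP->.
Qed.

Lemma unique_fixed_prime g s a p w0 :
    simple T -> ~~ abelian T -> 1 < k -> linear g s a ->
    val w0 = SDcoset T one_tup -> (forall w, g w = w -> w = w0) ->
    g != 1 -> prime p -> g ^+ p = 1 ->
  [/\ k = p, coprime #|T| p, a = 1, s ^+ p = 1 &
      exists2 i0, s i0 != i0 & forall i, i \in porbit s i0].
Proof.
move=> simT nabT k_gt1 lin_g def_w0 uniq_w0 ntg p_pr gp.
have const := unique_fixed_const lin_g def_w0 uniq_w0.
have [sp ap] : s ^+ p = 1 /\ a ^+ p = 1.
  by apply: linear_faithful => //; rewrite -gp; apply: linearX.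
have Aa := proj1 lin_g; have a1 : a 1 = 1 by rewrite -(autmE Aa) morph1.
have [t [Tt ntt at_t]] := simple_Aut_fixed_point simT nabT Aa p_pr ap.
have [i0 s_i0] : exists i0, s i0 != i0.
  apply/existsP; apply: contraT; rewrite negb_exists => /forallP s_id.
  have s1 : s = 1 by apply/permP=> i; rewrite perm1; apply/eqP; rewrite -[_ == _]negbK.
  pose j0 := Ordinal (ltnW k_gt1); pose j1 := Ordinal k_gt1.
  have := const _ 1 (single_tupN j0 Tt) (group1 T) _ j0 j1.
  rewrite !ffunE /= => e; case/eqP: ntt; apply: e => i.
  by rewrite !ffunE s1 invg1 perm1 mul1g; case: ifP.
have all_i0 i : i \in porbit s i0.
  apply: contraT => nOi.
  pose x : tup := [ffun i => if i \in porbit s i0 then t else 1].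
  have Nx : x \in N by apply/SDNP=> j; rewrite ffunE; case: ifP.
  have := const x 1 Nx (group1 T) _ i0 i.
  rewrite !ffunE (negPf nOi) porbit_id => e; case/eqP: ntt; apply: e => j.
  have eO : (s^-1 j \in porbit s i0) = (j \in porbit s i0).
    have {2}-> : j = (s ^+ 1) (s^-1 j) by rewrite expg1 permKV.
    by rewrite [RHS]porbit_sym porbit_perm porbit_sym.
  by rewrite !ffunE eO mul1g; case: ifP.
have k_p := prime_perm_transitive p_pr sp s_i0 all_i0.
have nts : s != 1 by apply: contraNneq s_i0 => ->; rewrite perm1.
have os : #[s] = p := nt_prime_order p_pr sp nts.
have idxP i : {m | i = (s ^+ m) i0}.
  by apply/sig_eqW; have /porbitP[m] := all_i0 i; exists m.
pose idx i := sval (idxP i); have idxE i : i = (s ^+ idx i) i0 := svalP (idxP i).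
have idx_mod i m : i = (s ^+ m) i0 -> idx i = m %[mod p].
  move=> def_i; have e0 : (s ^+ idx i) i0 = (s ^+ m) i0 by rewrite -idxE.
  apply/eqP; rewrite -os -eq_expg_mod_order; apply/eqP/permP=> j.
  rewrite (idxE j) -!permM -!expgD addnC [(_ + m)%N]addnC.
  by rewrite !expgD !permM e0.
have idxS i : idx i = (idx (s^-1 i)).+1 %[mod p].
  by apply: idx_mod; rewrite expgSr permM -idxE permKV.
have powS (hT : finGroupType) (y : hT) i : y ^+ p = 1 -> y ^+ idx i = y ^+ (idx (s^-1 i)).+1.
  by move=> yp; rewrite -(expg_mod _ yp) idxS expg_mod.
have a_1 : a = 1.
  apply/permP=> u; rewrite perm1.
  have [Tu | nTu] := boolP (u \in T); last exact: out_Aut Aa nTu.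
  pose x : tup := [ffun i => (a ^+ idx i) u].
  have Nx : x \in N by apply/SDNP=> j; rewrite ffunE Aut_closed ?groupX.
  have fix_x i : a (x (s^-1 i)) = 1 * x i.
    by rewrite !ffunE mul1g (powS _ a i ap) expgSr permM.
  have := const x 1 Nx (group1 T) fix_x i0 (s i0).
  have := fix_x (s i0); rewrite mul1g permK => <- e.
  have x_i0 : x i0 = u.
    have e0 : idx i0 = 0 %[mod p] by apply: idx_mod; rewrite expg0 perm1.
    by rewrite ffunE -(expg_mod _ ap) e0 mod0n perm1.
  by rewrite -[in RHS]x_i0 e x_i0.
split=> //; last by exists i0.
rewrite coprime_sym prime_coprime //; apply: contraT => /negPn p_T.
have [d Td od] := Cauchy p_pr p_T.
have dp : d ^+ p = 1 by rewrite -od expg_order.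
pose x : tup := [ffun i => d ^+ idx i].
have Nx : x \in N by apply/SDNP=> j; rewrite ffunE groupX.
have fix_x i : a (x (s^-1 i)) = d^-1 * x i.
  by rewrite a_1 perm1 !ffunE (powS _ d i dp) expgS mulKg.
have e := const x d^-1 Nx (groupVr Td) fix_x i0 (s i0).
have := fix_x (s i0); rewrite permK a_1 perm1 e.
move/(congr1 (fun z => z * (x (s i0))^-1)); rewrite mulgV mulgK => /esym/eqP.
rewrite invg_eq1 => /eqP d1; move: od; rewrite d1 order1 => p1.
by rewrite -p1 in p_pr.
Qed.

Lemma linear_fixed1 g s a w0 :
  linear g s a -> val w0 = SDcoset T one_tup -> g w0 = w0.
Proof.
move=> [Aa def_g] def_w0; apply: val_inj.
rewrite (def_g w0 one_tup one_tupN def_w0) def_w0; congr SDcoset.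
by apply/ffunP=> i; rewrite !ffunE -(autmE Aa) morph1.
Qed.

(* The power [g ^+ (#[g] %/ p)] acts on the coordinates as a [k]-cycle, whose
   centralizer is cyclic, so [s] has order [k] as well and that power is [g]. *)
Lemma quasi_semiregular_linear g s a w0 :
    simple T -> ~~ abelian T -> 1 < k -> linear g s a ->
    val w0 = SDcoset T one_tup -> (forall w, g w = w -> w = w0) ->
    (forall w m, w != w0 -> (g ^+ m) w = w -> g ^+ m = 1) ->
  [/\ prime k, coprime #|T| k, g \in SDSym k T & #[g] = k].
Proof.
move=> simT nabT k_gt1 lin_g def_w0 uniq_w0 semi_g.
have power p : prime p -> p %| #[g] ->
  let m := #[g] %/ p in
  [/\ k = p, coprime #|T| p, a ^+ m = 1, (s ^+ m) ^+ p = 1 &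
      exists2 i0, (s ^+ m) i0 != i0 & forall i, i \in porbit (s ^+ m) i0].
- move=> p_pr dvp m; have gmp : (g ^+ m) ^+ p = 1.
    by rewrite -expgM divnK // expg_order.
  have ntgm : g ^+ m != 1.
    rewrite -order_dvdn; apply/negP=> /dvdn_leq; rewrite divn_gt0 ?prime_gt0 //.
    rewrite dvdn_leq // => /(_ isT); rewrite leqNgt ltn_Pdiv ?prime_gt1 //.
  apply: (unique_fixed_prime simT nabT k_gt1 (linearX m lin_g) def_w0 _ ntgm p_pr gmp).
  by move=> w fix_w; apply: contraNeq ntgm => ne_w; apply/eqP; apply: semi_g fix_w.
have ntg : g != 1.
  apply/eqP=> g1; have /trivgPn[t Tt ntt] : T :!=: 1.
    by apply: contraNneq nabT => ->; apply: abelian1.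
  pose j0 := Ordinal (ltnW k_gt1); pose j1 := Ordinal k_gt1.
  have uniq1 w : (1 : {perm pt}) w = w -> w = w0 by move=> _; apply: uniq_w0; rewrite g1 perm1.
  have := unique_fixed_const (linear1) def_w0 uniq1 (single_tupN j0 Tt) (group1 T) _ j0 j1.
  rewrite !ffunE /= => e; case/eqP: ntt; apply: e => i.
  by rewrite perm1 invg1 perm1 mul1g.
have p_pr : prime (pdiv #[g]) by rewrite pdiv_prime // order_gt1.
have [k_p coTk am sm [i0 s_i0 all_i0]] := power _ p_pr (pdiv_dvd _).
set p := pdiv _ in p_pr k_p coTk am sm s_i0 all_i0; set m := #[g] %/ p in am sm s_i0 all_i0.
have nts : s ^+ m != 1 by apply: contraNneq s_i0 => ->; rewrite perm1.
have sp : s ^+ p = 1.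
  have /porbitP[b def_b] := all_i0 (s i0).
  have -> : s = (s ^+ m) ^+ b; last by rewrite -expgM mulnC expgM sm expg1n.
  apply/permP=> i; have /porbitP[c ->] := all_i0 i.
  have com : commute s (s ^+ m ^+ c) by do 2!apply: commuteX.
  by rewrite -[LHS]permM -com permM def_b -!permM -!expgD addnC.
have m1 : m = 1%N.
  apply/eqP; apply: contraNT nts => ne_m1.
  have m_gt0 : 0 < m by rewrite divn_gt0 ?prime_gt0 // dvdn_leq ?pdiv_dvd.
  have q_pr : prime (pdiv m) by rewrite pdiv_prime // ltn_neqAle eq_sym ne_m1.
  have dvq : pdiv m %| #[g].
    by apply: dvdn_trans (pdiv_dvd m) _; rewrite -[X in _ %| X](divnK (pdiv_dvd #[g])) dvdn_mulr.
  have [k_q _ _ _ _] := power _ q_pr dvq.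
  have /dvdnP[c ->] : p %| m by rewrite -k_p k_q pdiv_dvd.
  by rewrite mulnC expgM sp expg1n.
have og : #[g] = k by rewrite -(divnK (pdiv_dvd #[g])) -/p -/m m1 mul1n k_p.
split=> //; first by rewrite k_p.
  by rewrite k_p.
apply/SDSym_linear; exists s; move: lin_g am; rewrite m1 expg1 => lin_g a1.
by rewrite -a1.
Qed.

Lemma SDSym_quasi_semiregular g w0 :
    ~~ abelian T -> prime k -> coprime #|T| k -> val w0 = SDcoset T one_tup ->
    g \in SDSym k T -> #[g] = k ->
  quasi_semiregular g.
Proof.
move=> nabT k_pr coTk def_w0 /SDSym_linear[s lin_g] og; have k_gt1 := prime_gt1 k_pr.
have [sk _] : s ^+ k = 1 /\ (1 : {perm gT}) ^+ k = 1.
  by apply: linear_faithful => //; rewrite -[X in linear X](expg_order g) og; apply: linearX.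
exists w0.
have uniq m w : g ^+ m != 1 -> (g ^+ m) w = w -> w = w0.
  move=> ntgm fix_w; have := linearX m lin_g; rewrite expg1n => lin_gm.
  have [x Nx def_w] := SDptP w.
  have := proj2 lin_gm w x Nx def_w; rewrite fix_w def_w.
  move/eqP/SDcoset_eqP=> [d Td def_x].
  set r := s ^+ m in def_x.
  have rk : r ^+ k = 1 by rewrite /r -expgM mulnC expgM sk expg1n.
  have ntr : r != 1.
    by apply: contraNneq ntgm => r1; apply/eqP/linear_id; move: lin_gm; rewrite -/r r1.
  have step j i : x ((r ^- j) i) = d ^+ j * x i.
    elim: j i => [|j IHj] i; first by rewrite invg1 perm1 mul1g.
    rewrite expgSr invMg permM IHj; have := def_x i; rewrite !ffunE perm1 => ->.
    by rewrite mulgA expgSr.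
  have dk : d ^+ k = 1.
    have := step k (Ordinal (ltnW k_gt1)); rewrite rk invg1 perm1.
    by move/esym/(canRL (mulgK _)); rewrite mulgV.
  have d1 : d = 1.
    have : #[d] %| gcdn #|T| k by rewrite dvdn_gcd order_dvdG //= order_dvdn dk.
    by rewrite (eqP coTk) dvdn1 order_eq1 => /eqP.
  have [i0 r_i0] : exists i0, r i0 != i0.
    apply/existsP; apply: contraNT ntr; rewrite negb_exists => /forallP r_id.
    by apply/eqP/permP=> i; rewrite perm1; apply/eqP; rewrite -[_ == _]negbK.
  have all_i0 i : i \in porbit r i0.
    have : porbit r i0 = setT.
      apply/eqP; rewrite eqEcard subsetT cardsT card_ord.
      have := dvdn_orbit 'P%act <[r]> i0; rewrite -orderE (nt_prime_order k_pr rk ntr).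
      rewrite -porbitE; have [_ dvp] := primeP k_pr => /dvp/pred2P[O1|-> ]; last exact: leqnn.
      have /cards1P[z Oz] := introT eqP O1; case/eqP: r_i0.
      have := mem_porbit r 1 i0; have := porbit_id r i0.
      by rewrite Oz !inE expg1 => /eqP<- /eqP.
    by move=> ->; rewrite inE.
  apply: val_inj; rewrite def_w def_w0; apply/eqP; rewrite eq_sym; apply/SDcoset_eqP.
  exists (x i0); first exact: (SDNP _ Nx).
  move=> i; rewrite ffunE mulg1; have /porbitP[j ->] := all_i0 i.
  by rewrite -[in RHS](permK (r ^+ j) i0) step d1 expg1n mul1g.
split.
- exact: linear_fixed1 lin_g def_w0.
- by move=> w gw; apply: (uniq 1%N); rewrite expg1 // -order_gt1 og.
move=> w m ne_w fix_w; apply/eqP; apply: contraNT ne_w => nt.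
by apply/eqP; apply: uniq nt fix_w.
Qed.

End Diagonal.

Lemma quasi_semiregularJ (X : finType) (g h : {perm X}) :
  quasi_semiregular g -> quasi_semiregular (g ^ h).
Proof.
case=> w [gw uniq semi]; exists (h w).
have fixJ (f : {perm X}) x : (f ^ h) x = x -> f (h^-1 x) = h^-1 x.
  by rewrite conjgE !permM => e; apply: (@perm_inj _ h); rewrite e permKV.
split.
- by rewrite conjgE !permM permK gw.
- by move=> x /fixJ/uniq <-; rewrite permKV.
move=> x m ne_x; rewrite -conjXg => /fixJ fix_x.
rewrite (semi _ m _ fix_x) ?conj1g //.
by apply: contraNneq ne_x => <-; rewrite permKV.
Qed.

Theorem theorem5p4 (gT : finGroupType) (T : {group gT}) (k : nat) :
  simple T -> ~~ abelian T -> 2 <= k ->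
  ((exists g, g \in SDW k T /\ quasi_semiregular g) <-> (prime k /\ coprime #|T| k))
  /\
  (prime k -> coprime #|T| k ->
     forall g, g \in SDW k T ->
       (quasi_semiregular g <->
        exists h, exists s, [/\ h \in SDW k T, s \in SDSym k T, #[s] = k & g = s ^ h])).
Proof.
move=> simT nabT k_gt1.
have [w0 def_w0] := SDpt_exists (one_tupN T k).
have qsr_conj g : g \in SDW k T -> quasi_semiregular g ->
    [/\ prime k, coprime #|T| k &
      exists h, exists s, [/\ h \in SDW k T, s \in SDSym k T, #[s] = k & g = s ^ h]].
  move=> Wg [w [gw uniq semi]]; have [x Nx def_w] := SDptP w.
  have [r Wr def_rw0] := translation_exists Nx def_w0.
  have rw0 : r w0 = w by apply: val_inj; rewrite def_rw0.
  have [f def_f] : {f | f = g ^ r^-1} by exists (g ^ r^-1).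
  have def_g : g = f ^ r by rewrite def_f conjgKV.
  have fix_g (m : nat) v : (f ^+ m) v = v -> (g ^+ m) (r v) = r v.
    by rewrite def_g -conjXg conjgE !permM permK => ->.
  have fw0 : f w0 = w0 by rewrite def_f conjgE invgK !permM rw0 gw -rw0 permK.
  have Wf : f \in SDW k T by rewrite def_f groupJ ?groupV.
  have [n [s [a aff_f]]] := affine_SDW Wf.
  have [b lin_f] := affine_linear aff_f def_w0 fw0.
  have [|v m|k_pr coTk Sf of_] := quasi_semiregular_linear simT nabT k_gt1 lin_f def_w0.
  - move=> v fv; apply: (@perm_inj _ r); rewrite rw0; apply: uniq.
    by have := fix_g 1%N v; rewrite !expg1; apply.
  - move=> ne_v /fix_g/semi gm1; rewrite def_f -conjXg gm1 ?conj1g //.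
    by apply: contraNneq ne_v => rv; apply/eqP/(@perm_inj _ r); rewrite rv.
  by split=> //; exists r, f.
split; last first.
  move=> k_pr coTk g Wg; split=> [/(qsr_conj g Wg)[] // | [h [s [_ Ss os ->]]]].
  exact/quasi_semiregularJ/(SDSym_quasi_semiregular nabT k_pr coTk def_w0 Ss os).
split=> [[g [Wg /(qsr_conj g Wg)[]]] // | [k_pr coTk]].
have [s _ os] : {s : 'S_k | s \in [set: 'S_k] & #[s] = k}.
  by apply: Cauchy => //; rewrite cardsT card_Sn dvdn_fact // leqnn prime_gt0.
have [g lin_g] := linear_exists T s.
have Sg : g \in SDSym k T by apply/SDSym_linear; exists s.
exists g; split; first exact: SDSym_SDW.
apply: (SDSym_quasi_semiregular nabT k_pr coTk def_w0 Sg).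
apply: nt_prime_order => //.
  have sk : s ^+ k = 1 by apply/eqP; rewrite -order_dvdn os.
  by apply: linear_id; have := linearX k lin_g; rewrite expg1n sk.
apply: contraTneq k_pr => g1; rewrite -os.
rewrite g1 in lin_g; have [-> _] := linear_faithful nabT k_gt1 lin_g.
by rewrite order1.
Qed.
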